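(* For every positive integer $t$ there exists a positive integer $d$ such that for every $K_{t,t}$-induced-minor-free graph $G$ on $n$ vertices, $\mathrm{tw}_\alpha(G)\le O(\sqrt n\,(\log n)^d)$.
   Context: All graphs are finite and simple; $\log$ is base 2. A graph $H$ is an induced minor of $G$ if a graph isomorphic to $H$ can be obtained from $G$ by a sequence of vertex deletions and edge contractions (loops and parallel edges are removed); $G$ is $K_{t,t}$-induced-minor-free if $K_{t,t}$ is not an induced minor of $G$. A tree decomposition of $G$ is a pair $(T,\chi)$ with $T$ a tree and $\chi:V(T)\to 2^{V(G)}$ such that every edge of $G$ is contained in $\chi(x)$ for some $x\in V(T)$, and for every $v\in V(G)$ the set $\{x: v\in\chi(x)\}$ induces a non-empty connected subtree of $T$. Let $\alpha(H)$ be the maximum size of an independent set in $H$. The tree-independence number $\mathrm{tw}_\alpha(G)$ is the minimum over all tree decompositions $(T,\chi)$ of $G$ of $\max_{x\in V(T)}\alpha(G[\chi(x)])$. The $O$-notation is asymptotic as $n\to\infty$, and its constants depend only on $t$. *)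

(* Defs.v *)
From mathcomp Require Import all_boot all_order all_algebra.
From mathcomp Require Import boolp reals exp.

Set Implicit Arguments.
Unset Strict Implicit.
Unset Printing Implicit Defensive.

Import Order.TTheory GRing.Theory Num.Theory.

Record sgraph := SGraph {
  vertex :> finType;
  edge : rel vertex;
  edge_sym : symmetric edge;
  edge_irr : irreflexive edge }.

Definition graph_iso (G H : sgraph) : Prop :=
  exists2 f : G -> H, bijective f & forall x y : G, edge (f x) (f y) = edge x y.

Section Subgraphs.
Variable G : sgraph.

Section Induced.
Variable S : {set G}.

Definition induced_edge : rel {x : G | x \in S} :=
  fun x y => edge (val x) (val y).

Fact induced_sym : symmetric induced_edge.
Proof. by move=> x y; rewrite /induced_edge edge_sym. Qed.

Fact induced_irr : irreflexive induced_edge.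
Proof. by move=> x; rewrite /induced_edge edge_irr. Qed.

Definition induced : sgraph := SGraph induced_sym induced_irr.
End Induced.

Definition delete_vertex (v : G) : sgraph := induced [set~ v].

(* Contraction of the edge uv: v is dropped and u stands for the merged       *)
(* vertex, so u inherits the neighbours of v. Excluding val x = val y removes *)
(* the loop at u. This is meant to be used only when u and v are adjacent.    *)
Section Contract.
Variables u v : G.

Definition contract_edge : rel {x : G | x != v} :=
  fun x y => (val x != val y) &&
    [|| edge (val x) (val y),
        (val x == u) && edge v (val y)
      | (val y == u) && edge v (val x)].

Fact contract_sym : symmetric contract_edge.
Proof.
by move=> x y; rewrite /contract_edge eq_sym edge_sym; congr (_ && (_ || _));
   rewrite orbC.
Qed.

Fact contract_irr : irreflexive contract_edge.
Proof. by move=> x; rewrite /contract_edge eqxx. Qed.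

Definition contract : sgraph := SGraph contract_sym contract_irr.
End Contract.

End Subgraphs.

Inductive induced_minor (H : sgraph) : sgraph -> Prop :=
| induced_minor_iso (G : sgraph) :
    graph_iso H G -> induced_minor H G
| induced_minor_delete (G : sgraph) (v : G) :
    induced_minor H (delete_vertex v) -> induced_minor H G
| induced_minor_contract (G : sgraph) (u v : G) :
    edge u v -> induced_minor H (contract u v) -> induced_minor H G.

Section CompleteBipartite.
Variables m n : nat.

Definition Kmn_edge : rel ('I_m + 'I_n)%type :=
  fun x y => match x, y with
             | inl _, inr _ | inr _, inl _ => true
             | _, _ => false
             end.

Fact Kmn_sym : symmetric Kmn_edge.
Proof. by move=> [x|x] [y|y]. Qed.

Fact Kmn_irr : irreflexive Kmn_edge.
Proof. by move=> [x|x]. Qed.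

Definition complete_bipartite : sgraph := SGraph Kmn_sym Kmn_irr.
End CompleteBipartite.

Definition independent (G : sgraph) (S : {set G}) : bool :=
  [forall x in S, forall y in S, ~~ edge x y].

Definition independence_number (G : sgraph) : nat :=
  \max_(S : {set G} | independent S) #|S|.

Definition connected_graph (G : sgraph) : Prop :=
  (0 < #|G|)%N /\ forall x y : G, connect (@edge G) x y.

(* A two-element sequence [:: x; y] along an edge is a ucycle; hence the size *)
(* condition.                                                                 *)
Definition acyclic (G : sgraph) : Prop :=
  forall p : seq G, (2 < size p)%N -> ~ ucycle (@edge G) p.

Definition is_tree (T : sgraph) : Prop := connected_graph T /\ acyclic T.

Definition tree_decomposition (G T : sgraph) (chi : T -> {set G}) : Prop :=
  [/\ is_tree T,
      forall u v : G, edge u v -> exists x : T, u \in chi x /\ v \in chi x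
    & forall v : G, connected_graph (induced [set x : T | v \in chi x])].

Definition decomposition_alpha (G T : sgraph) (chi : T -> {set G}) : nat :=
  \max_(x : T) independence_number (induced (chi x)).

Definition decomposition_value (G : sgraph) (k : nat) : Prop :=
  exists (T : sgraph) (chi : T -> {set G}),
    tree_decomposition chi /\ decomposition_alpha chi = k.

Section OneBag.
Variable G : sgraph.

Let noedge : rel unit := fun _ _ => false.
Let noedge_sym : symmetric noedge. Proof. by []. Qed.
Let noedge_irr : irreflexive noedge. Proof. by []. Qed.

(* The decomposition with a single bag V(G), so that the minimum exists. *)
Fact decomposition_value_ex : exists k, `[< decomposition_value G k >].
Proof.
pose T := SGraph noedge_sym noedge_irr.
pose chi (_ : T) : {set G} := [set: G].
exists (decomposition_alpha chi); apply/asboolP; exists T, chi; split=> //.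
split.
- split; first by split=> [|[] []]; rewrite ?card_unit ?connect0.
  by move=> [|[] [|[] p]] // _ /andP[].
- by move=> u v _; exists tt; rewrite !inE.
- move=> v; have vT : tt \in [set x : T | v \in chi x] by rewrite !inE.
  split; first by apply/card_gt0P; exists (exist _ tt vT).
  by move=> x y; rewrite (_ : x = y) ?connect0 //; apply: val_inj; case: (val x) (val y) => [] [].
Qed.
End OneBag.

Definition tree_independence_number (G : sgraph) : nat :=
  ex_minn (decomposition_value_ex G).

Definition log2 (R : realType) (x : R) : R := (ln x / ln 2)%R.

(* Main.v *)
(* It suffices to find, in every induced subgraph, a balanced separator whose   *)
(* independence number is O(sqrt n polylog n): recursing on both sides and       *)
(* adding the separators to all bags below gives the tree decomposition.         *)
(*                                                                               *)
(* Separators come from the shallow-minor argument of Plotkin, Rao and Smith,    *)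
(* with the number of vertices replaced by the independence number alpha.  One   *)
(* grows a biclique model out of cheap connected sets A_i, B_j, where a vertex v *)
(* costs deg v = alpha(N[v]), so that deleting N[A_i] is affordable.  When some  *)
(* B_j is too far to be reached by a new A_i, a ball around it can be cut off    *)
(* along a boundary of small alpha.  As there is no K_{t,t} model, this yields   *)
(* for every T a separator with T alpha(S) at most polylog times                 *)
(* F + T^2, where F is the largest total degree of an independent set.           *)
(*                                                                               *)
(* It remains to see that F is at most alpha polylog.  A Kovari-Sos-Turan and    *)
(* Ramsey argument gives F <= alpha^2 / p once alpha is at least a power of p;   *)
(* with p polylogarithmic, the separators are then a small fraction of alpha,    *)
(* and since F is subadditive along separations, splitting recursively down to   *)
(* pieces of polylogarithmic alpha loses only a constant factor.                 *)

Require Import Defs.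
From mathcomp Require Import all_boot all_order all_algebra.
From mathcomp Require Import boolp reals exp.
From mathcomp Require Import zify.
Import Order.TTheory GRing.Theory Num.Theory.

Set Implicit Arguments.
Unset Strict Implicit.
Unset Printing Implicit Defensive.

(** * Connected, separated and independent vertex sets *)

(** Write F(W) for [walpha (deg W) W], the largest total degree of an independent set of W, and let
    n = [#|G|] be at most 2^l. A biclique model would give K_{t,t} as an induced minor
    ([biclique_model_induced_minor]), so there is none. Attempting to grow one inside W must
    therefore fail, and the failure leaves a set S whose removal breaks W into parts with at most
    half of alpha(W), where T alpha(S) is O(l F(W) + l T^2) ([separator], [separation]).

    If F(W) is at most polylog times alpha(W), then T close to sqrt n gives alpha(S) at most sqrt n
    times polylog for every W. Recursive separation has depth O(l), and adding S to all bags below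
    it yields the tree decomposition ([rooted_dec_join], [rooted_dec_of_separations]).

    The remaining point is [density], the bound on F, obtained by bootstrapping. The trivial F <=
    alpha^2 is too weak to give any useful separator. [a_priori] gains a factor p: many vertices of
    degree close to alpha would have large independent neighbourhoods, from which [dense_model]
    builds a biclique model. With p polylogarithmic, [small_separation] finds S with alpha(S) <=
    alpha(W)/(24 l). Since F is subadditive along separations ([walpha_deg_split]), splitting down
    to pieces of polylogarithmic alpha, where the trivial bound is good enough, loses only a
    constant factor ([density_rec]). *)

Section Sets.
Variable G : sgraph.
Implicit Types (P Q C W X Y Z I J : {set G}) (f g : G -> nat).

Definition nbh P : {set G} := [set y | (y \in P) || [exists x in P, edge x y]].

(** Anticomplete sets; disjointness is included so that alpha is superadditive on them. *)
Definition sep P Q := [forall x in P, forall y in Q, (x != y) && ~~ edge x y].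

Definition inside P : rel G := fun x y => [&& x \in P, y \in P & edge x y].

Definition conn P :=
  (P != set0) && [forall x in P, forall y in P, connect (inside P) x y].

Lemma sepP P Q :
  reflect (forall x y, x \in P -> y \in Q -> x != y /\ ~~ edge x y) (sep P Q).
Proof.
apply: (iffP forall_inP) => [h x y xP yQ|h x xP].
  by have /forall_inP/(_ y yQ)/andP := h x xP.
by apply/forall_inP => y yQ; apply/andP; exact: h.
Qed.

Lemma nsepP P Q :
  reflect (exists x y, [/\ x \in P, y \in Q & (x == y) || edge x y])
          (~~ sep P Q).
Proof.
apply: (iffP idP) => [|[x [y [xP yQ e]]]]; last first.
  apply/negP => /sepP/(_ x y xP yQ) [/negbTE nxy /negbTE ne].
  by rewrite nxy ne in e.
case/forall_inPn => x xP /forall_inPn[y yQ].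
by rewrite negb_and !negbK => e; exists x, y.
Qed.

Lemma sepC P Q : sep P Q = sep Q P.
Proof.
by apply/sepP/sepP => h x y xP yP; have [] := h _ _ yP xP;
  rewrite eq_sym edge_sym.
Qed.

Lemma sepS P Q P' Q' : P' \subset P -> Q' \subset Q -> sep P Q -> sep P' Q'.
Proof.
by move=> /subsetP sP /subsetP sQ /sepP h; apply/sepP => x y /sP xP /sQ yQ; auto.
Qed.

Lemma sepU P Q1 Q2 : sep P (Q1 :|: Q2) = sep P Q1 && sep P Q2.
Proof.
apply/idP/andP => [h|[/sepP h1 /sepP h2]].
  by split; apply: sepS h; rewrite ?subxx ?subsetUl ?subsetUr.
by apply/sepP => x y xP /setUP[] yQ; auto.
Qed.

Lemma sepUl P Q1 Q2 : sep (Q1 :|: Q2) P = sep Q1 P && sep Q2 P.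
Proof. by rewrite sepC sepU !(sepC P). Qed.

Lemma sep0 P : sep P set0.
Proof. by apply/sepP => x y _; rewrite inE. Qed.

Lemma sep0l P : sep set0 P.
Proof. by rewrite sepC sep0. Qed.

Lemma sep_disj P Q x : sep P Q -> x \in P -> x \in Q -> False.
Proof. by move=> /sepP h xP xQ; have [] := h x x xP xQ; rewrite eqxx. Qed.

Lemma nbhP P y :
  reflect (exists2 x, x \in P & (x == y) || edge x y) (y \in nbh P).
Proof.
rewrite inE; apply: (iffP orP) => [[yP|/exists_inP[x xP e]]|[x xP /orP[/eqP<-|e]]].
- by exists y; rewrite ?eqxx.
- by exists x; rewrite // e orbT.
- by left.
- by right; apply/exists_inP; exists x.
Qed.

Lemma nbh_self P : P \subset nbh P.
Proof. by apply/subsetP => x xP; rewrite inE xP. Qed.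

Lemma sep_nbh P Q : sep P Q = [disjoint nbh P & Q].
Proof.
apply/idP/idP => [h|].
  apply/pred0P => y /=; apply/negP => /andP[/nbhP[x xP e] yQ].
  have := h; apply/negP; apply/nsepP; by exists x, y.
apply: contraLR => /nsepP[x [y [xP yQ e]]].
by apply/pred0Pn; exists y; apply/andP; split=> //; apply/nbhP; exists x.
Qed.

Lemma nbhS P Q : P \subset Q -> nbh P \subset nbh Q.
Proof.
by move/subsetP => s; apply/subsetP => y /nbhP[x xP e]; apply/nbhP; exists x; auto.
Qed.

Lemma nbh1 x y : (y \in nbh [set x]) = (y == x) || edge x y.
Proof.
apply/nbhP/idP => [[z /set1P-> ]|e]; first by rewrite eq_sym.
by exists x; rewrite ?set11 // eq_sym.
Qed.

Lemma inside_sym P : symmetric (inside P).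
Proof. by move=> x y; rewrite /inside edge_sym; case: (x \in P); case: (y \in P). Qed.

Lemma connect_inside_sym P : connect_sym (inside P).
Proof. by apply: sym_connect_sym; exact: inside_sym. Qed.

Lemma connect_insideS P Q x y :
  P \subset Q -> connect (inside P) x y -> connect (inside Q) x y.
Proof.
move=> /subsetP s; apply: connect_sub => u v /and3P[uP vP e].
by apply: connect1; rewrite /inside !s.
Qed.

Lemma connP P :
  reflect (P != set0 /\ forall x y, x \in P -> y \in P -> connect (inside P) x y)
          (conn P).
Proof.
apply: (iffP andP) => [] [-> h]; split=> //.
  by move=> x y xP yP; have /forall_inP/(_ y yP) := forall_inP h x xP.
by apply/forall_inP => x xP; apply/forall_inP => y; exact: h.
Qed.

Lemma conn1 x : conn [set x].
Proof.
apply/connP; split; first by apply/set0Pn; exists x; rewrite inE.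
by move=> ? ? /set1P-> /set1P->; exact: connect0.
Qed.

Lemma conn_from P x :
  x \in P -> (forall y, y \in P -> connect (inside P) x y) -> conn P.
Proof.
move=> xP h; apply/connP; split; first by apply/set0Pn; exists x.
by move=> y z yP zP; apply: connect_trans (h _ zP); rewrite connect_inside_sym h.
Qed.

Lemma connU P Q : conn P -> conn Q -> ~~ sep P Q -> conn (P :|: Q).
Proof.
move=> /connP[_ hP] /connP[_ hQ] /nsepP[x [y [xP yQ e]]].
have xPQ : x \in P :|: Q by rewrite inE xP.
have yPQ : y \in P :|: Q by rewrite inE yQ orbT.
apply: (@conn_from _ x) => // z /setUP[zP|zQ].
  by apply: (connect_insideS (subsetUl _ _)); exact: hP.
apply: (@connect_trans _ _ y); last first.
  by apply: (connect_insideS (subsetUr _ _)); exact: hQ.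
by case/orP: e => [/eqP->//|e]; apply: connect1; rewrite /inside xPQ yPQ.
Qed.

Lemma connU_edge P Q x y :
  conn P -> conn Q -> x \in P -> y \in Q -> edge x y -> conn (P :|: Q).
Proof.
by move=> cP cQ xP yQ e; apply: connU => //; apply/nsepP; exists x, y; rewrite e orbT.
Qed.

Lemma connU_meet P Q x : conn P -> conn Q -> x \in P -> x \in Q -> conn (P :|: Q).
Proof.
by move=> cP cQ xP xQ; apply: connU => //; apply/nsepP; exists x, x; rewrite eqxx.
Qed.

Lemma conn_leave Q C :
  conn Q -> Q :&: C != set0 -> ~~ (Q \subset C) ->
  exists x y, [/\ x \in Q :&: C, y \in Q :\: C & edge x y].
Proof.
move=> /connP[_ hQ] /set0Pn[x0 /setIP[x0Q x0C]] /subsetPn[y0 y0Q y0C].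
have := hQ _ _ x0Q y0Q => /connectP[p]; elim: p x0 x0Q x0C => [|z p IH] x xQ xC /=.
  by move=> _ E; rewrite E xC in y0C.
case/andP => /and3P[_ zQ e] pth E.
have [zC|zC] := boolP (z \in C); first exact: IH zQ zC pth E.
by exists x, z; rewrite !inE xQ xC zQ zC.
Qed.

Lemma conn_sub_of_nbh Q C D :
  conn Q -> Q :&: C != set0 -> nbh C \subset C :|: D -> [disjoint Q & D] ->
  Q \subset C.
Proof.
move=> cQ QC /subsetP nC QD; apply: contraT => /(conn_leave cQ QC)[x [y []]].
rewrite !inE => /andP[xQ xC] /andP[yC yQ] e.
have /nC : y \in nbh C by apply/nbhP; exists x; rewrite // e orbT.
rewrite inE (negbTE yC) /= => yD.
by have /pred0P/(_ y) := QD; rewrite /= yQ yD.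
Qed.

(* [C] plays the role of a connected component of the subgraph induced by [Y]. *)
Lemma component_max Y Q :
  conn Q -> Q \subset Y ->
  exists C, [/\ conn C, Q \subset C, C \subset Y & nbh C :&: Y \subset C].
Proof.
move=> cQ QY.
pose p C := [&& conn C, Q \subset C & C \subset Y].
have pQ : p Q by rewrite /p cQ subxx QY.
have [C maxC QC'] := maxset_exists pQ.
have /and3P[cC QC CY] := maxsetp maxC.
exists C; split=> //; apply/subsetP => y /setIP[/nbhP[x xC /orP[/eqP<-//|e]] yY].
have <- : C :|: [set y] = C.
  apply: (maxsetsup maxC); last exact: subsetUl.
  rewrite /p (connU_edge cC (conn1 y) xC (set11 y) e) /=.
  by rewrite (subset_trans QC (subsetUl _ _)) subUset CY sub1set.
by rewrite !inE eqxx orbT.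
Qed.

Definition indep I := @independent G I.

Lemma indepP I :
  reflect (forall x y, x \in I -> y \in I -> ~~ edge x y) (indep I).
Proof.
apply: (iffP forall_inP) => [h x y xP yQ|h x xP].
  by have /forall_inP := h x xP; exact.
by apply/forall_inP => y yQ; exact: h.
Qed.

Lemma indepS I J : I \subset J -> indep J -> indep I.
Proof. by move=> /subsetP s /indepP h; apply/indepP => x y /s ? /s ?; auto. Qed.

Lemma indepU I J : indep I -> indep J -> sep I J -> indep (I :|: J).
Proof.
move=> /indepP hI /indepP hJ /sepP h; apply/indepP => x y /setUP[] xI /setUP[] yI; auto.
- by have [] := h _ _ xI yI.
- by rewrite edge_sym; have [] := h _ _ yI xI.
Qed.

Lemma indep0 : indep set0.
Proof. by apply/indepP => x y; rewrite inE. Qed.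

Lemma indep1 x : indep [set x].
Proof. by apply/indepP => y z /set1P-> /set1P->; rewrite edge_irr. Qed.

End Sets.

(** * Weighted independence numbers *)

Section WeightedAlpha.
Variable G : sgraph.
Implicit Types (P Q C W X Y Z I J : {set G}) (f g : G -> nat).

(* [alpha] is not additive, but it is subadditive and, on separated sets,       *)
(* superadditive: this replaces counting vertices throughout.                   *)
Definition walpha f Y :=
  \max_(I : {set G} | (I \subset Y) && indep I) \sum_(v in I) f v.

Definition alpha Y := walpha (fun=> 1) Y.

Lemma walpha_ge f Y I : I \subset Y -> indep I -> \sum_(v in I) f v <= walpha f Y.
Proof.
move=> IY iI; rewrite /walpha.
by rewrite (bigD1 I) ?IY ?iI //= leq_maxl.
Qed.

Lemma walpha_ex f Y :
  exists I, [/\ I \subset Y, indep I & \sum_(v in I) f v = walpha f Y].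
Proof.
have h0 : (0 < #|[pred I : {set G} | (I \subset Y) && indep I]|).
  by apply/card_gt0P; exists set0; rewrite inE sub0set indep0.
have [I /andP[IY iI] E] := eq_bigmax_cond (fun J : {set G} => \sum_(v in J) f v) h0.
by exists I; rewrite /walpha E.
Qed.

Lemma walphaS f Y Z : Y \subset Z -> walpha f Y <= walpha f Z.
Proof.
move=> YZ; have [I [IY iI <-]] := walpha_ex f Y.
by apply: walpha_ge iI; exact: subset_trans IY YZ.
Qed.

Lemma walphaU f Y Z : walpha f (Y :|: Z) <= walpha f Y + walpha f Z.
Proof.
have [I [IY iI <-]] := walpha_ex f (Y :|: Z).
have -> : \sum_(v in I) f v = \sum_(v in I :&: Y) f v + \sum_(v in I :\: Y) f v.
  rewrite (big_setID Y) //.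
apply: leq_add; apply: walpha_ge.
- exact: subsetIr.
- by apply: indepS iI; exact: subsetIl.
- apply/subsetP => x; rewrite !inE => /andP[xY xI].
  by have := subsetP IY x xI; rewrite inE (negbTE xY).
- by apply: indepS iI; exact: subsetDl.
Qed.

Lemma walpha_sepU f Y Z :
  sep Y Z -> walpha f Y + walpha f Z <= walpha f (Y :|: Z).
Proof.
move=> s.
have [I [IY iI <-]] := walpha_ex f Y; have [J [JZ iJ <-]] := walpha_ex f Z.
have sIJ : sep I J by apply: sepS s.
have dIJ : [disjoint I & J].
  by move: sIJ; rewrite sep_nbh => /(disjointWl (nbh_self I)).
apply: leq_trans (walpha_ge f (setUSS IY JZ) (indepU iI iJ sIJ)).
rewrite -bigU //=; apply: eq_leq; apply: eq_bigl => v.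
by rewrite !inE.
Qed.

Lemma walpha_sep f X Y Z : sep Y Z -> Y \subset X -> Z \subset X ->
  walpha f Y + walpha f Z <= walpha f X.
Proof.
move=> s YX ZX; apply: leq_trans (walpha_sepU f s) _.
by apply: walphaS; rewrite subUset YX.
Qed.

Lemma walpha0 f : walpha f set0 = 0.
Proof.
have [I [+ _ <-]] := walpha_ex f set0; rewrite subset0 => /eqP->.
by rewrite big_set0.
Qed.

Lemma walpha_leq f g k Y :
  (forall v, v \in Y -> f v <= k * g v) -> walpha f Y <= k * walpha g Y.
Proof.
move=> h; have [I [IY iI <-]] := walpha_ex f Y.
apply: leq_trans (leq_mul (leqnn k) (walpha_ge g IY iI)).
by rewrite big_distrr /=; apply: leq_sum => v vI; apply: h; exact: subsetP IY v vI.
Qed.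

Lemma walpha_gt0 f Y v : v \in Y -> f v <= walpha f Y.
Proof.
move=> vY; have := @walpha_ge f Y [set v]; rewrite big_set1; apply; last exact: indep1.
by rewrite sub1set.
Qed.

Lemma alpha_ge Y I : I \subset Y -> indep I -> #|I| <= alpha Y.
Proof. by move=> IY iI; rewrite -sum1_card; exact: walpha_ge. Qed.

Lemma alpha_ex Y : exists I, [/\ I \subset Y, indep I & #|I| = alpha Y].
Proof.
by have [I [? ? E]] := walpha_ex (fun=> 1) Y; exists I; rewrite -sum1_card.
Qed.

Lemma alpha_card Y : alpha Y <= #|Y|.
Proof. by have [I [IY _ <-]] := alpha_ex Y; exact: subset_leq_card. Qed.

Lemma alpha_eq0 Y : alpha Y = 0 -> Y = set0.
Proof.
move=> E; apply/eqP; apply: contraT => /set0Pn[v /walpha_gt0 h].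
by have := h (fun=> 1); rewrite -/(alpha Y) E.
Qed.

Lemma alphaS Y Z : Y \subset Z -> alpha Y <= alpha Z.
Proof. exact: walphaS. Qed.

Lemma alphaU Y Z : alpha (Y :|: Z) <= alpha Y + alpha Z.
Proof. exact: walphaU. Qed.

Lemma alpha_sep X Y Z : sep Y Z -> Y \subset X -> Z \subset X ->
  alpha Y + alpha Z <= alpha X.
Proof. exact: walpha_sep. Qed.

Lemma alpha0 : alpha set0 = 0.
Proof. exact: walpha0. Qed.

Lemma alpha_bigcup (A : {set G}) (F : G -> {set G}) :
  alpha (\bigcup_(v in A) F v) <= \sum_(v in A) alpha (F v).
Proof.
apply: (big_ind2 (fun (Y : {set G}) n => alpha Y <= n)) => //.
  by rewrite /alpha walpha0.
move=> Y m Z n hY hZ; apply: leq_trans (walphaU _ _ _) _; exact: leq_add.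
Qed.

(* Distinct indices with the same residue modulo [m] differ by at least [m], so *)
(* each residue class contributes at most [walpha f Y].                         *)
Lemma walpha_spread f Y (F : nat -> {set G}) m T : 0 < m ->
  (forall i, i < T -> F i \subset Y) ->
  (forall i j, j < T -> i + m <= j -> sep (F i) (F j)) ->
  \sum_(i < T) walpha f (F i) <= m * walpha f Y.
Proof.
move=> m0 FY Fsep.
have res r n : n <= T ->
  \sum_(i < n | i %% m == r) walpha f (F i)
    <= walpha f (\bigcup_(i < n | i %% m == r) F i).
  elim: n => [|n IH] nT; first by rewrite !big_ord0.
  rewrite big_mkcond big_ord_recr /= -big_mkcond /=.
  rewrite [X in _ <= walpha f X]big_mkcond big_ord_recr /= -big_mkcond /=.
  case: eqP => [E|_]; last by rewrite addn0 setU0; apply: IH; lia.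
  apply: leq_trans (leq_add (IH _) (leqnn _)) _; first lia.
  apply: walpha_sepU; rewrite sepC; apply/sepP => x y xF /bigcupP[i /eqP Ei yF].
  have /sepP h : sep (F i) (F n).
    apply: Fsep => //; have := ltn_ord i; move: (val i) Ei => k Ek kn.
    rewrite (divn_eq k m) (divn_eq n m) Ek E in kn *.
    have : k %/ m < n %/ m by rewrite -(ltn_pmul2r m0); lia.
    nia.
  by have [] := h _ _ yF xF; rewrite eq_sym edge_sym.
pose p (i : 'I_T) : 'I_m := Ordinal (ltn_pmod i m0).
rewrite (partition_big p predT) //=.
have -> : m * walpha f Y = \sum_(r < m) walpha f Y by rewrite sum_nat_const card_ord.
rewrite (eq_bigr (fun r : 'I_m => \sum_(i < T | i %% m == r) walpha f (F i))) //.
apply: leq_sum => r _; apply: leq_trans (res _ _ (leqnn T)) _.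
by apply: walphaS; apply/bigcupsP => i _; exact: FY.
Qed.

End WeightedAlpha.

Lemma walpha_lower (G : sgraph) (f : G -> nat) k (Y : {set G}) :
  (forall v, v \in Y -> k <= f v) -> k * alpha Y <= walpha f Y.
Proof.
move=> h; have [I [IY iI <-]] := alpha_ex Y.
apply: leq_trans (walpha_ge f IY iI); rewrite mulnC -sum_nat_const.
by apply: leq_sum => v vI; apply: h; exact: subsetP IY v vI.
Qed.

Lemma exists_below_average (F : nat -> nat) T M :
  0 < T -> \sum_(i < T) F i <= M -> exists2 i, i < T & T * F i <= M.
Proof.
move=> T0 h; have [i _ imin] := arg_minnP (fun i : 'I_T => F i) (isT : predT (Ordinal T0)).
exists i => //; apply: leq_trans h.
rewrite -[X in X * _]card_ord -sum_nat_const.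
by apply: leq_sum => j _; exact: imin.
Qed.

(** * Region growing *)

Section RegionGrowing.
Variables (G : sgraph) (w : G -> nat) (C src : {set G}).

Definition wt (P : {set G}) := \sum_(v in P) w v.

Lemma wtU P Q : wt (P :|: Q) <= wt P + wt Q.
Proof.
rewrite /wt (big_setID P) /= setUK leq_add2l setDUl setDv set0U.
by rewrite [X in _ <= X](big_setID P) /= leq_addl.
Qed.

(** Balls for the vertex-weighted distance from [src] inside C. Connected sets serve in place of
    paths, as only their unions are needed. *)
Definition ball (r : nat) : {set G} :=
  [set v in C | [exists P : {set G},
    [&& conn P, P \subset C, v \in P, ~~ [disjoint P & src] & wt P <= r]]].

Lemma ballP r v :
  reflect (v \in C /\ exists P : {set G}, [/\ conn P, P \subset C, v \in P,
             ~~ [disjoint P & src] & wt P <= r]) (v \in ball r).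
Proof.
rewrite inE; apply: (iffP andP) => [[vC /existsP[P /and5P[]]]|[vC [P [*]]]].
  by split=> //; exists P.
by split=> //; apply/existsP; exists P; apply/and5P.
Qed.

Lemma ball_sub r : ball r \subset C.
Proof. by apply/subsetP => v /ballP[]. Qed.

Lemma ballS r s : r <= s -> ball r \subset ball s.
Proof.
move=> rs; apply/subsetP => v /ballP[vC [P [? ? ? ? h]]]; apply/ballP.
by split=> //; exists P; split=> //; apply: leq_trans rs.
Qed.

Lemma ball_step r u v : u \in ball r -> v \in C -> edge u v -> v \in ball (r + w v).
Proof.
move=> /ballP[uC [P [cP PC uP Ps Pr]]] vC e; apply/ballP; split=> //.
exists (P :|: [set v]); split.
- exact: connU_edge cP (conn1 v) uP (set11 v) e.
- by rewrite subUset PC sub1set.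
- by rewrite !inE eqxx orbT.
- by apply: contra Ps => /(disjointWl (subsetUl _ _)).
- by apply: leq_trans (wtU _ _) _; rewrite {2}/wt big_set1 leq_add2r.
Qed.

Lemma ball_src v : v \in C -> v \in src -> v \in ball (w v).
Proof.
move=> vC vs; apply/ballP; split=> //; exists [set v]; split.
- exact: conn1.
- by rewrite sub1set.
- exact: set11.
- by rewrite disjoints1 vs.
- by rewrite /wt big_set1.
Qed.

Definition boundary r := (nbh (ball r) :&: C) :\: ball r.

Lemma boundary_ball r v : v \in boundary r -> v \in ball (r + w v).
Proof.
rewrite !in_setD in_setI => /andP[vB /andP[/nbhP[u uB /orP[/eqP E|e]] vC]].
  by rewrite E (negbTE vB) in uB.
exact: ball_step e.
Qed.

(* Within a dyadic weight class, boundaries at far apart radii are separated,   *)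
(* which is what makes averaging over the radius possible for [alpha].          *)
Definition wclass c : {set G} := [set v | trunc_log 2 (w v) == c].

Lemma boundary_sum (T K r : nat) :
  (forall v, v \in C -> 0 < w v < T) -> T <= 2 ^ K ->
  \sum_(i < T) alpha (boundary (r + i)) <= 4 * K * walpha w (ball (r + 2 * T)).
Proof.
move=> hw hK; set Z := ball (r + 2 * T).
have bC s v : v \in boundary s -> v \in C by rewrite !inE => /andP[_ /andP[]].
have cls v : v \in C -> forall c, v \in wclass c -> 2 ^ c <= w v < 2 ^ c.+1.
  by move=> /hw /andP[w0 _] c; rewrite inE => /eqP<-; exact: trunc_log_bounds.
apply: (@leq_trans (\sum_(i < T) \sum_(c < K) alpha (boundary (r + i) :&: wclass c))).
  apply: leq_sum => i _.
  apply: (@leq_trans (alpha (\bigcup_(c < K) (boundary (r + i) :&: wclass c)))).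
    apply: walphaS; apply/subsetP => v vb; have /hw/andP[w0 wT] := bC _ _ vb.
    have cK : trunc_log 2 (w v) < K.
      rewrite -(@ltn_exp2l 2) //; apply: leq_ltn_trans (trunc_logP _ w0) _ => //.
      exact: leq_trans wT hK.
    by apply/bigcupP; exists (Ordinal cK); rewrite // !inE eqxx andbT; rewrite !inE in vb.
  apply: (big_ind2 (fun (Y : {set G}) n => alpha Y <= n)) => //.
    by rewrite /alpha walpha0.
  by move=> Y m Y' n hY hY'; apply: leq_trans (walphaU _ _ _) _; exact: leq_add.
rewrite exchange_big /= [4 * K]mulnC -mulnA -[X in X * _](card_ord K) -sum_nat_const.
apply: leq_sum => c _.
(* A boundary vertex of class c at radius r + i lies, with its neighbours of that class, in the ball
   of radius r + i + 2^(c+2), so radii that far apart give separated pieces. Weights of at least 2^c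
   turn the factor 2^(c+2) into 4. *)
apply: (@leq_trans (2 ^ (c + 2) * alpha (Z :&: wclass c))).
  apply: (@walpha_spread _ _ _ (fun i => boundary (r + i) :&: wclass c)).
  - by rewrite expn_gt0.
  - move=> i iT; apply/subsetP => v /setIP[vb vc]; rewrite inE vc andbT.
    have /hw/andP[_ wT] := bC _ _ vb.
    by apply: (subsetP (ballS _)) (boundary_ball vb); lia.
  move=> i j jT ij; apply/sepP => u v /setIP[ub uc] /setIP[vb vc].
  have /andP[_ wu] := cls _ (bC _ _ ub) _ uc.
  have /andP[_ wv] := cls _ (bC _ _ vb) _ vc.
  have vB : v \notin ball (r + j) by move: vb; rewrite inE => /andP[].
  have uB := boundary_ball ub.
  have E : 2 ^ (c + 2) = 2 ^ c.+1 + 2 ^ c.+1 by rewrite addn2 [LHS]expnS; lia.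
  split; first apply: contra vB => [/eqP<-]; last apply: contra vB => e.
    by apply: (subsetP (ballS _)) uB; lia.
  by apply: (subsetP (ballS _)) (ball_step uB (bC _ _ vb) e); lia.
rewrite expnD -mulnA [_ * alpha _]mulnC mulnA mulnC leq_mul //.
apply: leq_trans (walphaS w (subsetIl Z (wclass c))).
apply: walpha_lower => v /setIP[vZ vc].
by have /andP[] := cls v (subsetP (ball_sub _) v vZ) _ vc.
Qed.

(** Along the radii T + 2Tj the weighted alpha of the ball cannot double J times and stay below 2^J.
    Where it at most doubles, averaging over T intermediate radii gives a cheap boundary. *)
Lemma region_growing (T K J : nat) :
  (forall v, v \in C -> 0 < w v < T) -> T <= 2 ^ K -> walpha w C < 2 ^ J ->
  ~~ [disjoint C & src] ->
  exists r, [/\ r <= T * (2 * J + 1), ball r != set0 &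
    T * alpha (boundary r) <= 8 * K * walpha w (ball r)].
Proof.
move=> hw hK hJ /pred0Pn[u /andP[uC us]]; have /andP[w0 wT] := hw u uC.
pose r j := T + 2 * T * j; pose phi j := walpha w (ball (r j)).
have uB s : T <= s -> u \in ball s.
  by move=> Ts; apply: (subsetP (ballS _)) (ball_src uC us); lia.
have [j jJ hj] : exists2 j, j < J & phi j.+1 <= 2 * phi j.
  have [[j hj]|no] := @existsP _ (fun j : 'I_J => phi j.+1 <= 2 * phi j).
    by exists j.
  have : forall j, j <= J -> 2 ^ j <= phi j.
    elim=> [_|j IH jJ].
      by apply: leq_trans (walpha_gt0 w (uB _ _)) => //; rewrite /r; lia.
    have : ~~ (phi j.+1 <= 2 * phi j).
      by apply/negP => hj; apply: no; exists (Ordinal jJ).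
    by have := IH (ltnW jJ); rewrite expnS; lia.
  move=> /(_ J (leqnn J)) h.
  by have := walphaS w (ball_sub (r J)); rewrite -/(phi J); lia.
have T0 : 0 < T by lia.
have hS := boundary_sum (r j) hw hK.
have rE : r j + 2 * T = r j.+1 by rewrite /r; lia.
rewrite rE -/(phi j.+1) in hS.
have [i iT hi] := @exists_below_average (fun i => alpha (boundary (r j + i))) _ _ T0 hS.
exists (r j + i); split.
- rewrite /r; nia.
- by apply/set0Pn; exists u; apply: uB; rewrite /r; lia.
- apply: leq_trans hi _.
  have : phi j <= walpha w (ball (r j + i)) by apply/walphaS/ballS/leq_addr.
  nia.
Qed.

End RegionGrowing.

(** * Balanced separators *)

Section Models.
Variable G : sgraph.
Implicit Types (A B : {set G}) (As Bs : seq {set G}).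

(** Branch sets realizing a complete bipartite graph as an induced minor; [sep] within each side is
    what makes the minor induced. *)
Definition partial_model As Bs :=
  [/\ all (@conn G) As, all (@conn G) Bs, pairwise (@sep G) As, pairwise (@sep G) Bs
    & {in As & Bs, forall A B, [disjoint A & B] /\ ~~ sep A B}].

Definition biclique_model t :=
  exists As Bs, [/\ partial_model As Bs, size As = t & size Bs = t].

Lemma partial_modelC As Bs : partial_model As Bs -> partial_model Bs As.
Proof.
case=> h1 h2 h3 h4 h5; split=> // B A hB hA.
by rewrite disjoint_sym sepC; exact: h5.
Qed.

Lemma partial_model_rem As Bs B : partial_model As Bs -> partial_model As (rem B Bs).
Proof.
have s := rem_subseq B Bs.
case=> h1 h2 h3 h4 h5; split=> //.
- by apply/allP => A /(mem_subseq s); exact: (allP h2).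
- exact: subseq_pairwise s h4.
- by move=> A B' hA /(mem_subseq s); exact: h5.
Qed.

Definition cov As : {set G} := \bigcup_(A <- As) nbh A.

Lemma covP As x : reflect (exists2 A, A \in As & x \in nbh A) (x \in cov As).
Proof.
rewrite /cov; elim: As => [|A As IH].
  by rewrite big_nil inE; constructor; case.
rewrite big_cons in_setU; apply: (iffP orP) => [[h|/IH[B hB h]]|[B]].
- by exists A; rewrite // inE eqxx.
- by exists B; rewrite // inE hB orbT.
- rewrite inE => /orP[/eqP->|hB h]; first by left.
  by right; apply/IH; exists B.
Qed.

Lemma cov_cons A As : cov (A :: As) = nbh A :|: cov As.
Proof. by rewrite /cov big_cons. Qed.

Lemma sep_cov C As : {in As, forall A, sep C A} -> [disjoint C & cov As].
Proof.
move=> h; apply/pred0P => x /=; apply/negP => /andP[xC /covP[A hA xA]].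
have := h A hA; rewrite sepC sep_nbh => /pred0P/(_ x) /=.
by rewrite xA xC.
Qed.

End Models.

(** * Separators from a growing biclique model *)

Section Separator.
Variables (G : sgraph) (t : nat) (W : {set G}) (T K J : nat).

Definition deg (v : G) := alpha (nbh [set v] :&: W).

Hypothesis nomodel : ~ biclique_model G t.
Hypothesis hK : T <= 2 ^ K.
Hypothesis hJ : walpha deg W < 2 ^ J.

Let w := deg.
Let H : {set G} := [set v in W | T <= w v].
Let a := alpha W.
Let R := T * (2 * J + 1).
(** Cost of a branch set: a start vertex and, for each of at most t opposite sets, a connection
    through two balls of radius R and one further vertex. *)
Let Rb := T + t * (2 * R + T).
Implicit Types (A B C D X Y Q Lay : {set G}) (As Bs : seq {set G}).

Let goal := exists S : {set G}, [/\ S \subset W,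
  T * alpha S <= 8 * K * walpha w W + T * alpha H + T * (2 * t * Rb)
  & forall Q, conn Q -> Q \subset W :\: S -> 2 * alpha Q <= a].

Let S_of Lay As Bs := Lay :|: ((cov As :|: cov Bs) :&: W).

Let good Lay X As Bs :=
  [/\ [/\ H \subset Lay, Lay \subset W & X \subset W],
      T * alpha Lay <= 8 * K * walpha w X + T * alpha H,
      partial_model As Bs, size As <= t /\ size Bs <= t
    & {in As ++ Bs, forall A, alpha (nbh A :&: W) <= Rb}].

Let main C Lay As Bs :=
  [/\ conn C, C \subset W :\: H, a < 2 * alpha C
    & nbh C :&: W \subset C :|: S_of Lay As Bs].

(* [C] is the part still to be separated, [Lay] the vertices cut so far, paid    *)
(* for by the discarded region [X], and [As], [Bs] a partial biclique model, all *)
(* of whose neighbourhoods currently belong to the separator.                    *)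
Let state C Lay X As Bs :=
  [/\ good Lay X As Bs, main C Lay As Bs, sep X C
    & {in As ++ Bs, forall A, sep C A}].

Let S_ofC Lay As Bs : S_of Lay As Bs = S_of Lay Bs As.
Proof. by rewrite /S_of (setUC (cov As)). Qed.

Let stateC C Lay X As Bs : state C Lay X As Bs -> state C Lay X Bs As.
Proof.
case=> [[h1 h2 h3 [h4 h4'] h5] [h6 h7 h8 h9] h10 h11]; split=> //.
- split=> //; first exact: partial_modelC.
  by move=> A; rewrite mem_cat orbC -mem_cat; exact: h5.
- by split; rewrite // S_ofC.
- by move=> A; rewrite mem_cat orbC -mem_cat; exact: h11.
Qed.

Let alpha_cov As : {in As, forall A, alpha (nbh A :&: W) <= Rb} ->
  alpha (cov As :&: W) <= size As * Rb.
Proof.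
elim: As => [|A As IH] h; first by rewrite /cov big_nil set0I /alpha walpha0.
rewrite cov_cons setIUl /= mulSn; apply: leq_trans (walphaU _ _ _) _.
apply: leq_add; first by apply: h; rewrite inE eqxx.
by apply: IH => B hB; apply: h; rewrite inE hB orbT.
Qed.

(* A connected subset avoiding [C] and its neighbours competes with [C] for    *)
(* independent vertices, so only the part inside [C] can still be too big.     *)
Let shrink C D Lay X As Bs :
  good Lay X As Bs -> main C Lay As Bs -> D \subset C -> D \subset S_of Lay As Bs ->
  goal \/ exists C', C' \subset C :\: D /\ main C' Lay As Bs.
Proof.
move=> [[HL LW XW] hL hm [sA sB] hR] [cC CW aC nC] DC DS.
have [[Q [cQ QCD aQ]]|no] := pselect (exists Q, [/\ conn Q, Q \subset C :\: D & a < 2 * alpha Q]).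
  right; have [C' [cC' QC' C'D nC']] := component_max cQ QCD.
  have C'C : C' \subset C by apply: subset_trans C'D (subsetDl _ _).
  exists C'; split=> //; split=> //.
  - exact: subset_trans CW.
  - by apply: leq_trans aQ _; rewrite leq_pmul2l //; exact: walphaS.
  - apply/subsetP => y /setIP[yC' yW].
    have : y \in nbh C :&: W by rewrite inE yW (subsetP (nbhS C'C)).
    move/(subsetP nC)/setUP => [yC|yS]; apply/setUP; last by right.
    have [yD|yD] := boolP (y \in D); first by right; exact: (subsetP DS).
    left.
    by apply: (subsetP nC'); rewrite in_setI yC' in_setD yD.
left; exists (S_of Lay As Bs); split.
- by rewrite subUset LW subsetIr.
- have : alpha (S_of Lay As Bs) <= alpha Lay + 2 * t * Rb.
    apply: leq_trans (walphaU _ _ _) _; rewrite leq_add2l setIUl.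
    apply: leq_trans (walphaU _ _ _) _.
    apply: leq_trans (leq_add (alpha_cov _) (alpha_cov _)) _.
    + by move=> A hA; apply: hR; rewrite mem_cat hA.
    + by move=> A hA; apply: hR; rewrite mem_cat hA orbT.
    + by rewrite -mulnDl leq_mul2r mul2n -addnn leq_add ?orbT.
  have h2 := walphaS w XW; move=> h1.
  apply: leq_trans (leq_mul (leqnn T) h1) _; rewrite mulnDr leq_add2r.
  by apply: leq_trans hL _; rewrite leq_add2r leq_mul2l h2 orbT.
- move=> Q cQ QS.
  have nCW : nbh C \subset C :|: (S_of Lay As Bs :|: ~: W).
    apply/subsetP => y yC; rewrite !in_setU in_setC.
    have [yW|] := boolP (y \in W); last by rewrite !orbT.
    have := subsetP nC y; rewrite in_setI yC yW => /(_ isT).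
    by rewrite !in_setU orbF.
  have dQ : [disjoint Q & S_of Lay As Bs :|: ~: W].
    apply/pred0P => y /=; apply/negP => /andP[/(subsetP QS)].
    by rewrite in_setD in_setU in_setC => /andP[/negbTE-> ->].
  have [QC0|QC] := eqVneq (Q :&: C) set0.
    have sQ : sep C Q.
      rewrite sep_nbh; apply/pred0P => y /=; apply/negP => /andP[/(subsetP nCW)].
      rewrite in_setU => /orP[yC|yS] yQ.
        by have := in_set0 y; rewrite -QC0 inE yC yQ.
      by have /pred0P/(_ y) := dQ; rewrite /= yS yQ.
    have := alpha_sep sQ (subset_trans CW (subsetDl _ _))
              (subset_trans QS (subsetDl _ _)).
    by move: aC; rewrite /a; clear; lia.
  have QsC := conn_sub_of_nbh cQ QC nCW dQ.
  rewrite leqNgt; apply/negP => aQ; apply: no; exists Q; split=> //.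
  apply/subsetP => y yQ; rewrite in_setD (subsetP QsC y yQ) andbT.
  apply/negP => /(subsetP DS) yS.
  by have := subsetP QS y yQ; rewrite in_setD yS.
Qed.

(* Adding a branch set or cutting removes vertices from [C]; dropping a branch   *)
(* set leaves [C] alone.                                                         *)
Let mu C As Bs := #|C| * (2 * t).+1 + size As + size Bs.

Section Step.
Variables (C : {set G}) (Lay X : {set G}) (As Bs : seq {set G}).
Hypothesis st : state C Lay X As Bs.
Hypothesis IH : forall C' Lay' X' As' Bs', state C' Lay' X' As' Bs' ->
  mu C' As' Bs' < mu C As Bs -> goal.

(** A light piece Y with a cheap boundary can be discarded: the boundary joins [Lay] and Y joins the
    region X that pays for it. The budget stays valid because X is separated from C, so that
    [walpha w] adds up. *)
Let cut Y : Y \subset C -> Y != set0 -> 2 * alpha Y <= a ->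
  T * alpha ((nbh Y :&: C) :\: Y) <= 8 * K * walpha w Y -> goal.
Proof.
move=> YC Y0 aY hY; set L := (nbh Y :&: C) :\: Y in hY.
have [[[HL LW XW] hL hm [sA sB] hR] [cC CW aC nC] sXC sC] := st.
have CW' : C \subset W by apply: subset_trans CW (subsetDl _ _).
have LC : L \subset C by apply: subset_trans (subsetDl _ _) (subsetIr _ _).
have hg : good (Lay :|: L) (X :|: Y) As Bs.
  split=> //; first split.
  - exact: subset_trans HL (subsetUl _ _).
  - by rewrite subUset LW (subset_trans LC).
  - by rewrite subUset XW (subset_trans YC).
  - have h1 : alpha (Lay :|: L) <= alpha Lay + alpha L by apply: walphaU.
    have h2 : walpha w X + walpha w Y <= walpha w (X :|: Y).
      by apply: walpha_sepU; apply: sepS sXC.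
    apply: leq_trans (leq_mul (leqnn T) h1) _; rewrite mulnDr.
    apply: leq_trans (leq_add hL hY) _.
    by rewrite addnAC -mulnDr leq_add2r leq_mul2l h2 orbT.
have hS : S_of Lay As Bs \subset S_of (Lay :|: L) As Bs by rewrite setSU // subsetUl.
have hmn : main C (Lay :|: L) As Bs.
  by split=> //; apply: subset_trans nC _; rewrite setUS.
have LS : L \subset S_of (Lay :|: L) As Bs.
  by apply/subsetP => y yL; rewrite !in_setU yL orbT.
have [//|[C' [C'D hm']]] := shrink hg hmn LC LS.
have C'C : C' \subset C by apply: subset_trans C'D (subsetDl _ _).
have nY : nbh Y \subset Y :|: (L :|: ~: C).
  apply/subsetP => y yY; rewrite !in_setU in_setC in_setD in_setI yY.
  by case: (y \in Y); case: (y \in C).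
have dC' : [disjoint C' & L :|: ~: C].
  apply/pred0P => y /=; apply/negP => /andP[/(subsetP C'D)].
  by rewrite in_setD in_setU in_setC => /andP[/negbTE-> ->].
(* A connected C' that met Y would lie inside Y, which has at most half of alpha(W). *)
have C'Y : C' :&: Y = set0.
  apply/eqP; apply: contraT => h; have [cC' _ aC' _] := hm'.
  have /alphaS := conn_sub_of_nbh cC' h nY dC'.
  by move: aC' aY; clear; lia.
have sYC' : sep Y C'.
  rewrite sep_nbh; apply/pred0P => y /=; apply/negP => /andP[/(subsetP nY)].
  rewrite in_setU => /orP[yY|yS] yC'.
    by have := in_set0 y; rewrite -C'Y inE yY yC'.
  by have /pred0P/(_ y) := dC'; rewrite /= yS yC'.
apply: (@IH C' (Lay :|: L) (X :|: Y) As Bs).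
  split=> //; first by rewrite sepUl sYC' andbT; apply: sepS sXC.
  by move=> A /sC; apply: sepS.
have : #|C'| < #|C|.
  have /subset_leq_card : C' :|: Y \subset C by rewrite subUset C'C.
  rewrite cardsU C'Y cards0 subn0; move: Y0; rewrite -card_gt0; clear; lia.
by rewrite /mu; clear; nia.
Qed.

(* [y] lets a new member of [As] reach [B] from [C] without touching [As].        *)
Let alive B := exists y, [/\ y \in nbh C :&: W, y \in nbh B, y \notin C
  & (y \notin Lay) && (y \notin cov As)].

(** The ball found by region growing holds more than half of alpha(W), since a lighter one could be
    cut off. *)
Let grow (src : {set G}) : ~~ [disjoint C & src] -> ~ goal ->
  exists r, [/\ r <= R, ball w C src r != set0 & a < 2 * alpha (ball w C src r)].
Proof.
move=> hs ng.
have [[[HL LW XW] _ _ _ _] [cC CW aC nC] _ _] := st.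
have CW' : C \subset W by apply: subset_trans CW (subsetDl _ _).
have wC v : v \in C -> 0 < w v < T.
  move=> vC; have := subsetP CW v vC; rewrite in_setD inE => /andP[+ vW].
  rewrite vW /= -ltnNge => ->; rewrite andbT.
  have : v \in nbh [set v] :&: W by rewrite inE vW (subsetP (nbh_self _)) ?set11.
  by move/(walpha_gt0 (fun=> 1)).
have hJC : walpha w C < 2 ^ J by apply: leq_ltn_trans (walphaS _ CW') hJ.
have [r [rR b0 hb]] := region_growing wC hK hJC hs.
exists r; split=> //; rewrite ltnNge; apply/negP => h; apply: ng.
exact: cut (ball_sub _ _ _ _) b0 h hb.
Qed.

(** Two balls in C, around v0 and around the vertices of C next to a usable neighbour of B, each
    hold more than half of alpha(W), so they are not separated. Joining them costs at most 2R. *)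
Let link v0 B : v0 \in C -> ~ goal -> alive B ->
  exists P y p, [/\ [/\ conn P, P \subset C, v0 \in P & wt w P <= 2 * R],
    [/\ p \in P, edge p y & y \in nbh B], y \in nbh C :&: W
    & (y \notin Lay) && (y \notin cov As)].
Proof.
move=> v0C ng [y0 [y0C y0B y0nC y0L]].
have s0 : ~~ [disjoint C & [set v0]] by rewrite disjoint_sym disjoints1 negbK.
pose ok y := [&& y \in nbh C :&: W, y \in nbh B, y \notin Lay & y \notin cov As].
pose src : {set G} := [set c in C | [exists y, ok y && edge c y]].
have s1 : ~~ [disjoint C & src].
  have /setIP[/nbhP[c cC /orP[/eqP E|e]] _] := y0C.
    by rewrite -E cC in y0nC.
  apply/pred0Pn; exists c; rewrite /= cC inE cC /=; apply/existsP; exists y0.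
  by rewrite e andbT /ok y0C y0B.
have [r0 [r0R _ a0]] := grow s0 ng; have [r1 [r1R _ a1]] := grow s1 ng.
have /nsepP[x [x' [/ballP[xC [P [cP PC xP Ps Pr]]] /ballP[x'C [P' [cP' P'C xP' Ps' Pr']]] e]]] :
    ~~ sep (ball w C [set v0] r0) (ball w C src r1).
  apply/negP => s; have [_ [cC CW _ _] _ _] := st.
  have CW' : C \subset W by apply: subset_trans CW (subsetDl _ _).
  have := alpha_sep s (subset_trans (ball_sub _ _ _ _) CW')
            (subset_trans (ball_sub _ _ _ _) CW').
  by move: a0 a1; rewrite /a; clear; lia.
have v0P : v0 \in P by move: Ps; rewrite disjoint_sym disjoints1 negbK.
have /pred0Pn[p /andP[pP' /=]] := Ps'.
rewrite inE => /andP[pC /existsP[y /andP[/and4P[yC yB yL yA] epy]]].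
exists (P :|: P'), y, p; split=> //.
- split.
  + by apply: connU => //; apply/nsepP; exists x, x'.
  + by rewrite subUset PC.
  + by rewrite inE v0P.
  + apply: leq_trans (wtU _ _ _) _; by move: Pr Pr' r0R r1R; clear; lia.
- by split=> //; apply/setUP; right.
- by rewrite yL.
Qed.

(** The new branch set is a union of connections from a common v0 in C, one for each B. All its
    vertices avoid [cov As], so it is separated from [As]; it is disjoint from [Bs] because it lies
    in the neighbourhood of C, and C is separated from [Bs]. *)
Lemma add_branch_set : size As < t -> {in Bs, forall B, alive B} -> goal.
Proof.
move=> sAt hal; have [//|ng] := pselect goal.
have [[[HL LW XW] hL hm [sA sB] hR] [cC CW aC nC] sXC sC] := st.
have CW' : C \subset W by apply: subset_trans CW (subsetDl _ _).
have [/set0Pn[v0 v0C] _] := connP _ cC.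
have wlt v : v \in W -> v \notin H -> w v < T.
  by move=> vW; rewrite inE vW /= -ltnNge.
have dCA : [disjoint C & cov As].
  by apply: sep_cov => A hA; apply: sC; rewrite mem_cat hA.
have [A [cA v0A hwA hA hAB]] : exists A, [/\ conn A, v0 \in A,
    wt w A <= T + size Bs * (2 * R + T),
    {in A, forall x, x \in nbh C :&: W /\ x \notin cov As}
    & {in Bs, forall B, ~~ sep A B}].
  move: hal; elim: (Bs) => [|B Bs' IHB] hal.
    exists [set v0]; split=> //; first exact: conn1.
    - exact: set11.
    - rewrite /wt big_set1 addn0; apply: ltnW.
      have := subsetP CW v0 v0C; rewrite in_setD => /andP[vH vW]; exact: wlt.
    - move=> x /set1P->; split; first by rewrite inE (subsetP (nbh_self C)) ?(subsetP CW').
      by apply/negP => xA; have /pred0P/(_ v0) := dCA; rewrite /= v0C xA.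
  have [|A [cA v0A hwA hA hAB]] := IHB.
    by move=> B' hB'; apply: hal; rewrite inE hB' orbT.
  have [|P [y [p [[cP PC v0P hwP] [pP epy yB] yC /andP[yL yA]]]]] := link v0C ng (hal B _).
    by rewrite inE eqxx.
  have cPy := connU_edge cP (conn1 y) pP (set11 y) epy.
  exists (A :|: (P :|: [set y])); split.
  - by apply: (connU_meet (x := v0)) => //; rewrite inE v0P.
  - by rewrite inE v0A.
  - have h1 := wtU w A (P :|: [set y]); have h2 := wtU w P [set y].
    have h3 : wt w [set y] < T.
      rewrite /wt big_set1; have /setIP[_ yW] := yC; apply: wlt => //.
      by apply: contra yL; exact: (subsetP HL).
    by rewrite /= mulSn; move: h1 h2 h3 hwA hwP; clear; lia.
  - move=> x /setUP[/hA//|/setUP[/(subsetP PC) xC|/set1P->//]].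
    split; first by rewrite inE (subsetP (nbh_self C)) ?(subsetP CW').
    by apply/negP => xA; have /pred0P/(_ x) := dCA; rewrite /= xC xA.
  - move=> B'; rewrite inE => /orP[/eqP->|hB'].
      apply/nsepP; have /nbhP[b bB e] := yB.
      exists y, b; split=> //; first by rewrite !inE eqxx !orbT.
      by rewrite eq_sym edge_sym.
    by apply: contra (hAB _ hB'); apply: sepS => //; exact: subsetUl.
have hg : good Lay X (A :: As) Bs.
  have [m1 m2 m3 m4 m5] := hm.
  split=> //.
  - split=> //=; first by rewrite cA.
    + rewrite m3 andbT; apply/allP => A' hA'; rewrite sepC sep_nbh.
      apply/pred0P => x /=; apply/negP => /andP[xA' /hA[_ /negP]]; apply.
      by apply/covP; exists A'.
    + move=> A' B; rewrite inE => /orP[/eqP->|hA'] hB; last exact: m5.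
      split; last exact: hAB.
      apply/pred0P => x /=; apply/negP => /andP[/hA[/setIP[xC _] _] xB].
      have := sC B; rewrite mem_cat hB orbT => /(_ isT).
      by rewrite sep_nbh => /pred0P/(_ x); rewrite /= xC xB.
  - move=> A'; rewrite inE => /orP[/eqP->|]; last exact: hR.
    apply: (@leq_trans (wt w A)); last first.
      by apply: leq_trans hwA _; rewrite leq_add2l leq_mul2r sB orbT.
    apply: leq_trans (alpha_bigcup _ _); apply: walphaS.
    apply/subsetP => x /setIP[/nbhP[v vA e] xW]; apply/bigcupP; exists v => //.
    by rewrite inE xW andbT; apply/nbhP; exists v; rewrite ?set11.
have hmn : main C Lay (A :: As) Bs.
  split=> //; apply: subset_trans nC _; rewrite setUS // setUS // setSI //.
  by rewrite cov_cons -setUA subsetUr.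
have DS : nbh A :&: C \subset S_of Lay (A :: As) Bs.
  apply/subsetP => x /setIP[xA xC].
  by rewrite !in_setU in_setI cov_cons !in_setU xA (subsetP CW' x xC) orbT.
have [//|[C' [C'D hm']]] := shrink hg hmn (subsetIr _ _) DS.
have C'C : C' \subset C by apply: subset_trans C'D (subsetDl _ _).
apply: (@IH C' Lay X (A :: As) Bs).
  split=> //; first by apply: sepS sXC.
  move=> A'; rewrite inE => /orP[/eqP->|/sC]; last exact: sepS.
  rewrite sepC sep_nbh; apply/pred0P => x /=; apply/negP => /andP[xA xC'].
  have := subsetP C'D x xC'; rewrite in_setD in_setI xA /= => /andP[/negP h xC].
  exact: h.
have : #|C'| < #|C|.
  apply: proper_card; apply/properP; split=> //; exists v0 => //.
  apply/negP => /(subsetP C'D); rewrite in_setD in_setI v0C andbT.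
  by rewrite (subsetP (nbh_self A) v0 v0A).
have: 0 < t by apply: leq_ltn_trans sAt.
by rewrite /mu /=; clear; nia.
Qed.

(** If B is not alive, every neighbour of C in W that B covers already lies in C, [Lay] or [cov As],
    so dropping B leaves C enclosed. *)
Lemma drop_branch_set B : B \in Bs -> ~ alive B -> goal.
Proof.
move=> hB nal.
have [[[HL LW XW] hL hm [sA sB] hR] [cC CW aC nC] sXC sC] := st.
have hrem : {subset rem B Bs <= Bs} by exact: mem_rem.
have sz : size (rem B Bs) = (size Bs).-1 by rewrite size_rem.
have sz0 : 0 < size Bs by case: (Bs) hB.
apply: (@IH C Lay X As (rem B Bs)); last by rewrite /mu sz; by move: sz0; clear; lia.
split=> //.
- split=> //; first exact: partial_model_rem.
  + by split=> //; rewrite sz; by move: sB; clear; lia.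
  + by move=> A; rewrite mem_cat => /orP[hA|/hrem hA]; apply: hR; rewrite mem_cat hA ?orbT.
- split=> //; apply/subsetP => y yC; have /setIP[_ yW] := yC.
  have := subsetP nC y yC; rewrite !in_setU !in_setI !in_setU yW !andbT.
  case/or4P => [->//|->|->|/covP[B' hB' yB']]; rewrite ?orbT //.
  have [E|nE] := eqVneq B' B; last first.
    have hB'' : B' \in rem B Bs.
      by move: hB'; rewrite (perm_mem (perm_to_rem hB)) inE (negbTE nE).
    by have -> : y \in cov (rem B Bs); [apply/covP; exists B' | rewrite !orbT].
  apply/negP => /negP; rewrite !negb_or => /and4P[y1 y2 y3 y4].
  by apply: nal; exists y; rewrite -E yB' y2 y3.
- by move=> A; rewrite mem_cat => /orP[hA|/hrem hA]; apply: sC; rewrite mem_cat hA ?orbT.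
Qed.

End Step.

(** Induction on [mu], with [stateC] exchanging the two sides: drop a branch set that is not alive,
    otherwise enlarge a side with fewer than t sets. Two sides of t sets contradict [nomodel]. *)
Lemma state_goal C Lay X As Bs : state C Lay X As Bs -> goal.
Proof.
have [n] := ubnP (mu C As Bs); elim: n C Lay X As Bs => // n IHn C Lay X As Bs hn st.
have IH C' Lay' X' As' Bs' : state C' Lay' X' As' Bs' ->
    mu C' As' Bs' < mu C As Bs -> goal.
  by move=> st' hlt; apply: IHn st'; apply: leq_trans hlt _.
have IH' C' Lay' X' As' Bs' : state C' Lay' X' As' Bs' ->
    mu C' As' Bs' < mu C Bs As -> goal.
  by move=> st' hlt; apply: IH st' _; move: hlt; rewrite /mu; clear; lia.
have [[_ _ hm [sA sB] _] _ _ _] := st.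
pose alive As B := exists y, [/\ y \in nbh C :&: W, y \in nbh B, y \notin C
  & (y \notin Lay) && (y \notin cov As)].
have [hB|] := pselect {in Bs, forall B, alive As B}; last first.
  by move=> /existsNP[B] /not_implyP[hB nB]; exact: (drop_branch_set st IH hB).
have [hA|] := pselect {in As, forall A, alive Bs A}; last first.
  by move=> /existsNP[A] /not_implyP[hA nA]; exact: (drop_branch_set (stateC st) IH' hA).
have [sAt|sAt] := ltnP (size As) t; first exact: (add_branch_set st IH).
have [sBt|sBt] := ltnP (size Bs) t; first exact: (add_branch_set (stateC st) IH').
by case: nomodel; exists As, Bs; split=> //; by move: sA sB sAt sBt; clear; lia.
Qed.

Lemma separator_aux : goal.
Proof.
have HW : H \subset W by apply/subsetP => x; rewrite inE => /andP[].
have [[Q [cQ QW aQ]]|no] := pselect (exists Q, [/\ conn Q, Q \subset W :\: H & a < 2 * alpha Q]).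
  have [C [cC QC CW nC]] := component_max cQ QW.
  (* The vertices of H are cut from the start, so that all weights in C are below T. *)
  apply: (@state_goal C H set0 [::] [::]); split=> //.
  - by split=> //=; [rewrite sub0set | rewrite walpha0; by clear; lia].
  - split=> //; first by apply: leq_trans aQ _; rewrite leq_pmul2l //; exact: walphaS.
    apply/subsetP => y /setIP[yC yW]; rewrite in_setU.
    have [yH|yH] := boolP (y \in H); first by rewrite in_setU yH orbT.
    by rewrite (subsetP nC) // in_setI yC in_setD yH.
  - exact: sep0l.
exists H; split=> //; first by clear; lia.
by move=> Q cQ QS; rewrite leqNgt; apply/negP => aQ; apply: no; exists Q.
Qed.

(* Vertices of degree at least [T] contribute at most [walpha deg W] in total.  *)
Theorem separator : exists S : {set G}, [/\ S \subset W,
  T * alpha S <= (8 * K + 1) * walpha deg W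
                 + T * (2 * t * (T + t * (2 * (T * (2 * J + 1)) + T)))
  & forall Q, conn Q -> Q \subset W :\: S -> 2 * alpha Q <= alpha W].
Proof.
have [S [SW hS hQ]] := separator_aux; exists S; split=> //.
apply: leq_trans hS _; rewrite leq_add2r mulnDl mul1n leq_add2l.
apply: (@leq_trans (walpha w H)).
  by apply: walpha_lower => v; rewrite inE => /andP[].
by apply: walphaS; apply/subsetP => x; rewrite inE => /andP[].
Qed.

End Separator.

(** * Counting and Ramsey lemmas *)

Lemma bin_leq_expn n k : 'C(n, k) <= n ^ k.
Proof.
apply: (@leq_trans (n ^_ k)).
  by rewrite -bin_ffact leq_pmulr ?fact_gt0.
by elim: k => // k IH; rewrite ffactnSr expnSr leq_mul // leq_subr.
Qed.

Lemma subset_of_size (T : finType) (A : {set T}) k :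
  k <= #|A| -> exists2 B : {set T}, B \subset A & #|B| = k.
Proof.
move=> kA; exists [set x in take k (enum A)].
  by apply/subsetP => x; rewrite inE => /mem_take; rewrite mem_enum.
rewrite cardsE; have /card_uniqP-> : uniq (take k (enum A)).
  by apply: take_uniq; exact: enum_uniq.
by rewrite size_takel // -cardE.
Qed.

Lemma card_bigcup (T I : finType) (P : pred I) (F : I -> {set T}) :
  #|\bigcup_(i | P i) F i| <= \sum_(i | P i) #|F i|.
Proof.
apply: (big_ind2 (fun (Y : {set T}) n => #|Y| <= n)) => [|Y m Z n hY hZ|//].
  by rewrite cards0.
by apply: leq_trans (leq_card_setU _ _) _; exact: leq_add.
Qed.

Lemma card_bigcup_leq (T I : finType) (A : {set I}) (F : I -> {set T}) k :
  (forall i, i \in A -> #|F i| <= k) -> #|\bigcup_(i in A) F i| <= #|A| * k.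
Proof.
move=> h; apply: leq_trans (card_bigcup _ _) _.
by rewrite -sum_nat_const; apply: leq_sum.
Qed.

(* A digraph with small out-degrees has a vertex of small in-degree, so deleting *)
(* the neighbourhood of such a vertex costs a bounded factor.                    *)
Lemma sparse_digraph_stable (T : finType) (D : rel T) d (J : {set T}) : 0 < d ->
  (forall v, v \in J -> #|[set u in J | D v u]| < d) ->
  exists J' : {set T}, [/\ J' \subset J, #|J| <= 2 * d * #|J'|
    & {in J' &, forall u v, u != v -> ~~ D u v}].
Proof.
move=> d0; have [n] := ubnP #|J|; elim: n J => // n IH J hn hd.
have [->|J0] := eqVneq J set0.
  by exists set0; rewrite cards0; split=> // u v; rewrite inE.
have countE (p : pred T) : #|[set u in J | p u]| = \sum_(u in J) p u.
  by rewrite -sum1dep_card big_mkcondr; apply: eq_bigr => u _; case: (p u).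
have [v vJ hv] : exists2 v, v \in J & #|[set u in J | D u v]| <= d.-1.
  apply/exists_inP; apply: contraT => /exists_inPn h.
  have : \sum_(v in J) \sum_(u in J) D v u <= \sum_(v in J) d.-1.
    apply: leq_sum => v vJ; have := hd v vJ.
    by rewrite countE; case: (d) d0.
  rewrite exchange_big /= leqNgt => /negP; case.
  have [v0 v0J] := set0Pn _ J0.
  rewrite (bigD1 v0) //= [X in _ < X](bigD1 v0) //= -addSn.
  have col v : v \in J -> d.-1 < \sum_(u in J) D u v.
    by move=> /h; rewrite -ltnNge countE.
  apply: leq_add; first exact: col.
  by apply: leq_sum => v /andP[/col/ltnW].
pose N := v |: ([set u in J | D v u] :|: [set u in J | D u v]).
have cN : #|N| <= 2 * d.
  apply: leq_trans (leq_card_setU _ _) _; rewrite cards1.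
  have /leqifP := leq_card_setU [set u in J | D v u] [set u in J | D u v].
  by have := hd v vJ; case: ifP => _; [move=> ? /eqP | ]; lia.
have NJ : N \subset J.
  by apply/subsetP => u /setU1P[->//|/setUP[]]; rewrite inE => /andP[].
have vN : v \in N by rewrite !inE eqxx.
have sz : #|J :\: N| = #|J| - #|N| by rewrite cardsD (setIidPr NJ).
have N0 : 0 < #|N| by apply/card_gt0P; exists v.
have NJ' := subset_leq_card NJ.
have [||J' [J'J hJ' hst]] := IH (J :\: N).
- by rewrite sz; lia.
- move=> u /setDP[uJ _]; apply: leq_ltn_trans (hd u uJ); apply: subset_leq_card.
  by apply/subsetP => x; rewrite !inE => /andP[/andP[_ ->]].
have vJ' : v \notin J' by apply/negP => /(subsetP J'J); rewrite in_setD vN.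
exists (v |: J'); split.
- by rewrite subUset sub1set vJ (subset_trans J'J) ?subsetDl.
- rewrite cardsU1 vJ' /=; nia.
- move=> x y /setU1P[->|xJ] /setU1P[->|yJ]; rewrite ?eqxx // => xy.
  + have /setDP[yJ2] := subsetP J'J y yJ.
    by apply: contra => D1; rewrite !inE yJ2 D1 orbT.
  + have /setDP[xJ2] := subsetP J'J x xJ.
    by apply: contra => D1; rewrite !inE xJ2 D1 !orbT.
  + exact: hst.
Qed.

(** A maximal e-free subset of J dominates J. If it has fewer than r elements, one of them has at
    least r^s neighbours, and induction applies among these. *)
Lemma ramsey (T : finType) (e : rel T) r s (J : {set T}) : symmetric e -> 0 < r ->
  r ^ s <= #|J| ->
  (exists X : {set T}, [/\ X \subset J, #|X| = s
     & {in X &, forall u v, u != v -> e u v}]) \/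
  (exists X : {set T}, [/\ X \subset J, #|X| = r
     & {in X &, forall u v, u != v -> ~~ e u v}]).
Proof.
move=> esym r0; elim: s J => [|s IH] J hJ.
  by left; exists set0; rewrite sub0set cards0; split=> // u v; rewrite inE.
pose st (X : {set T}) :=
  (X \subset J) && [forall u in X, forall v in X, (u != v) ==> ~~ e u v].
have stP (X : {set T}) : reflect (X \subset J /\ {in X &, forall u v, u != v -> ~~ e u v}) (st X).
  apply: (iffP andP) => [] [XJ h]; split=> //.
    by move=> u v uX vX; have /forall_inP/(_ v vX)/implyP := forall_inP h u uX.
  by apply/forall_inP => u uX; apply/forall_inP => v vX; apply/implyP; exact: h.
have st0 : st set0 by apply/stP; rewrite sub0set; split=> // u v; rewrite inE.
have [I maxI _] := maxset_exists st0.
have /stP[IJ hI] := maxsetp maxI.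
have [rI|Ir] := leqP r #|I|.
  right; have [X XI cX] := subset_of_size rI; exists X; split=> //.
    exact: subset_trans IJ.
  by move=> u v uX vX; apply: hI; exact: (subsetP XI).
pose N v : {set T} := [set u in J | (u != v) && e v u].
have cov : J \subset \bigcup_(v in I) (v |: N v).
  apply/subsetP => u uJ; apply: contraT => nu.
  have uI : u \notin I.
    by apply: contra nu => uI; apply/bigcupP; exists u; rewrite ?inE ?eqxx.
  have ne v : v \in I -> ~~ e v u.
    move=> vI; apply: contra nu => evu; apply/bigcupP; exists v => //.
    rewrite !inE uJ evu andbT; exact: orbN.
  suff E : u |: I = I by rewrite -E !inE eqxx in uI.
  apply: (maxsetsup maxI); last exact: subsetUr.
  apply/stP; split; first by rewrite subUset sub1set uJ.
  move=> x y /setU1P[->|xI] /setU1P[->|yI]; rewrite ?eqxx // => xy.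
  - by rewrite esym; exact: ne.
  - exact: ne.
  - exact: hI.
have [v vI hv] : exists2 v, v \in I & r ^ s <= #|N v|.
  apply/exists_inP; apply: contraT => /exists_inPn h.
  have hk v : v \in I -> #|v |: N v| <= r ^ s.
    move=> vI; have := h v vI; rewrite -ltnNge => h1.
    by rewrite cardsU1 !inE eqxx andbF.
  have := leq_trans (subset_leq_card cov) (card_bigcup_leq hk).
  rewrite leqNgt => /negP; case; apply: leq_trans hJ; rewrite expnS ltn_mul2r Ir andbT expn_gt0 r0 //.
have NJ : N v \subset J by apply/subsetP => u; rewrite inE => /andP[].
case: (IH (N v) hv) => [] [X [XN cX hX]]; [left|right; exists X; split=> //].
  have vX : v \notin X by apply/negP => /(subsetP XN); rewrite !inE eqxx andbF.
  exists (v |: X); split.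
  - by rewrite subUset sub1set (subsetP IJ) ?(subset_trans XN).
  - by rewrite cardsU1 vX cX.
  - move=> x y /setU1P[->|xX] /setU1P[->|yX]; rewrite ?eqxx // => xy.
    + by have := subsetP XN y yX; rewrite inE => /and3P[].
    + by have := subsetP XN x xX; rewrite inE esym => /and3P[].
    + exact: hX.
exact: subset_trans NJ.
Qed.

(** * Independent sets have subquadratic total degree *)

Section APriori.
Variables (G : sgraph) (t : nat).
Hypothesis nomodel : ~ biclique_model G t.
Implicit Types (I J W X Y Z : {set G}) (S : G -> {set G}).

Definition nb (v : G) : {set G} := [set u | edge v u].

(** Singletons serve as branch sets, since both sides are independent. *)
Lemma no_biclique J Y : indep J -> indep Y -> t <= #|J| -> t <= #|Y| ->
  {in J & Y, forall u y, edge u y} -> False.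
Proof.
move=> iJ iY tJ tY hJY; apply: nomodel.
have single (X : {set G}) : indep X -> t <= #|X| -> exists Xs : seq {set G},
    [/\ all (@conn G) Xs, pairwise (@sep G) Xs, size Xs = t
      & {in Xs, forall A, exists2 x, x \in X & A = [set x]}].
  move=> /indepP iX tX; exists [seq [set x] | x <- take t (enum X)]; split.
  - by apply/allP => A /mapP[x _ ->]; exact: conn1.
  - rewrite pairwise_map; apply: (@sub_in_pairwise _ (mem X) (fun x y => x != y)).
    + move=> x y xX yX /= xy; apply/sepP => _ _ /set1P-> /set1P->.
      by split=> //; exact: iX.
    + by apply/allP => x /mem_take; rewrite mem_enum.
    + by rewrite -uniq_pairwise take_uniq // enum_uniq.
  - by rewrite size_map size_takel // -cardE.
  - by move=> A /mapP[x /mem_take]; rewrite mem_enum => xX ->; exists x.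
have [As [cA pA sA hA]] := single J iJ tJ.
have [Bs [cB pB sB hB]] := single Y iY tY.
exists As, Bs; split=> //; split=> // _ _ /hA[u uJ ->] /hB[y yY ->].
have e := hJY u y uJ yY; split.
  by rewrite disjoints1 inE; apply/eqP => E; rewrite E edge_irr in e.
by apply/nsepP; exists u, y; rewrite !set11 e orbT.
Qed.

(** Let each y choose t of its neighbours in J. A t-subset chosen by more than t vertices would give
    a biclique, and there are at most [#|J| ^ t] subsets. *)
Lemma few_rich J Y : indep J -> indep Y -> (forall y, y \in Y -> t <= #|J :&: nb y|) ->
  #|Y| <= t * #|J| ^ t.
Proof.
move=> iJ iY h.
pose U y := [set x in take t (enum (J :&: nb y))].
have UP y : y \in Y -> U y \in [set A : {set G} | A \subset J & #|A| == t].
  move=> yY; rewrite inE; apply/andP; split.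
    by apply/subsetP => x; rewrite inE => /mem_take; rewrite mem_enum inE => /andP[].
  rewrite cardsE; have /card_uniqP-> : uniq (take t (enum (J :&: nb y))).
    by apply: take_uniq; exact: enum_uniq.
  by rewrite size_takel // -cardE h.
rewrite -sum1_card (partition_big U (mem [set A : {set G} | A \subset J & #|A| == t])) //=.
apply: (@leq_trans (\sum_(A in [set A : {set G} | A \subset J & #|A| == t]) t)).
  apply: leq_sum => A; rewrite inE => /andP[AJ /eqP cA].
  rewrite sum1dep_card leqNgt; apply/negP => tlt.
  apply: (@no_biclique A [set y in Y | U y == A]).
  - exact: indepS iJ.
  - by apply: indepS iY; apply/subsetP => y; rewrite inE => /andP[].
  - by rewrite cA.
  - exact: ltnW.
  - move=> u y uA; rewrite inE => /andP[yY /eqP E].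
    move: uA; rewrite -E inE => /mem_take; rewrite mem_enum !inE => /andP[_].
    by rewrite edge_sym.
by rewrite sum_nat_const cards_draws mulnC leq_mul2l bin_leq_expn orbT.
Qed.

(** Double counting as in the Kovari-Sos-Turan theorem: vertices of Y with fewer than t neighbours
    in J contribute at most t each, and the few others at most [#|J|] each. *)
Lemma kst J Y : indep J -> indep Y ->
  \sum_(v in J) #|Y :&: nb v| <= t * #|Y| + t * #|J| ^ t.+1.
Proof.
move=> iJ iY.
have -> : \sum_(v in J) #|Y :&: nb v| = \sum_(y in Y) #|J :&: nb y|.
  rewrite (eq_bigr (fun v => \sum_(y in Y) (edge v y : nat))); last first.
    move=> v _; rewrite -sum1_card; rewrite [RHS](eq_bigr (fun y => if edge v y then 1 else 0)).
      by rewrite -big_mkcondr; apply: eq_bigl => y; rewrite !inE.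
    by move=> y _; case: edge.
  rewrite exchange_big; apply: eq_bigr => y _.
  rewrite -sum1_card; rewrite [LHS](eq_bigr (fun v => if edge y v then 1 else 0)).
    by rewrite -big_mkcondr; apply: eq_bigl => v; rewrite !inE.
  by move=> v _; rewrite edge_sym; case: edge.
pose Y1 := [set y in Y | t <= #|J :&: nb y|].
have hY1 : #|Y1| <= t * #|J| ^ t.
  apply: few_rich => //; last by move=> y; rewrite inE => /andP[].
  by apply: indepS iY; apply/subsetP => y; rewrite inE => /andP[].
have Y1Y : Y1 \subset Y by apply/subsetP => y; rewrite inE => /andP[].
rewrite (big_setID Y1) /= (setIidPr Y1Y) addnC; apply: leq_add.
  apply: (@leq_trans (\sum_(y in Y :\: Y1) t)).
    apply: leq_sum => y; rewrite !inE => /andP[+ yY]; rewrite yY -ltnNge.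
    exact: ltnW.
  by rewrite sum_nat_const mulnC leq_mul2l subset_leq_card ?orbT // subsetDl.
apply: (@leq_trans (\sum_(y in Y1) #|J|)).
  by apply: leq_sum => y _; apply: subset_leq_card; exact: subsetIl.
by rewrite sum_nat_const expnSr mulnA leq_mul2r hY1 orbT.
Qed.

(** By [kst], d vertices of J cannot all have b neighbours in Y. *)
Lemma few_heavy a b d J Y : indep J -> indep Y -> #|Y| <= a ->
  t * a + t * d ^ t.+1 < d * b -> (forall v, v \in J -> b <= #|Y :&: nb v|) ->
  #|J| < d.
Proof.
move=> iJ iY Ya hd hb; rewrite ltnNge; apply/negP => dJ.
have [J' J'J cJ'] := subset_of_size dJ.
have := kst (indepS J'J iJ) iY; rewrite cJ' => hk.
have : d * b <= \sum_(v in J') #|Y :&: nb v|.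
  by rewrite -cJ' -sum_nat_const; apply: leq_sum => v /(subsetP J'J); exact: hb.
have := leq_mul (leqnn t) Ya; lia.
Qed.

Lemma card_sum_sep (s : seq G) S : uniq s ->
  (forall v, v \in s -> indep (S v)) ->
  {in s &, forall u v, u != v -> sep (S u) (S v)} ->
  \sum_(v <- s) #|S v| <= alpha (\bigcup_(v <- s) S v).
Proof.
elim: s => [|x s IH] /=; first by rewrite !big_nil.
move=> /andP[xs us] hi hs; rewrite !big_cons.
have hsep : sep (S x) (\bigcup_(v <- s) S v).
  rewrite big_seq; apply: (big_ind (fun Y => sep (S x) Y)) => [|Y Z|v vs].
  - exact: sep0.
  - by rewrite sepU => -> ->.
  - apply: hs; rewrite ?inE ?eqxx ?vs ?orbT //.
    by apply: contraNneq xs => ->.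
apply: leq_trans (walpha_sepU _ hsep); apply: leq_add.
  by apply: alpha_ge => //; apply: hi; rewrite inE eqxx.
apply: IH => // [v vs|u v us' vs]; first by apply: hi; rewrite inE vs orbT.
by apply: hs; rewrite inE ?us' ?vs orbT.
Qed.

(** * Models from many large independent neighbourhoods *)

Section Dense.
Variables (W J : {set G}) (S : G -> {set G}) (a b d r M sg : nat).
Hypothesis alphaW : alpha W <= a.
Hypothesis iJ : indep J.
Hypothesis SW : forall v, v \in J -> S v \subset W.
Hypothesis Snb : forall v, v \in J -> S v \subset nb v.
Hypothesis iS : forall v, v \in J -> indep (S v).
Hypothesis cS : forall v, v \in J -> sg <= #|S v|.
(** [h1] feeds [few_heavy], [h2] excludes r pairwise unlinked vertices, [h3] bounds the vertices
    spoiled during the greedy choice, and [h4] makes J large enough for thinning out followed by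
    Ramsey. *)
Hypothesis h1 : t * a + t * d ^ t.+1 < d * b.
Hypothesis h2 : a + r * (r * (2 * M + b)) < r * sg.
Hypothesis h3 : 4 * t ^ 2 * (b + d) + 4 * t ^ 3 * b <= M.
Hypothesis h4 : 2 * d * r ^ (2 * t) <= #|J|.

Let Sa v : v \in J -> #|S v| <= a.
Proof. by move=> vJ; apply: leq_trans alphaW; apply: alpha_ge; auto. Qed.

Let b0 : 0 < b. Proof. by case: (b) h1; [rewrite muln0|]. Qed.
Let d0 : 0 < d. Proof. by case: (d) h1. Qed.
Let r0 : 0 < r. Proof. by case: (r) h2. Qed.

(** Robust adjacency of S u and S v: an edge survives the removal of any M vertices. *)
Let linked u v := [forall Z : {set G}, (#|Z| <= M) ==>
  [exists y in S u :\: Z, exists z in S v :\: Z, edge y z]].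

Let linkedP u v Z : linked u v -> #|Z| <= M ->
  exists y z, [/\ y \in S u :\: Z, z \in S v :\: Z & edge y z].
Proof.
move=> /forallP/(_ Z)/implyP h /h /exists_inP[y yS /exists_inP[z zS e]].
by exists y, z.
Qed.

Let linkedC : symmetric linked.
Proof.
have half u v : linked u v -> linked v u.
  move=> h; apply/forallP => Z; apply/implyP => hZ.
  have [y [z [yS zS e]]] := linkedP h hZ.
  by apply/exists_inP; exists z => //; apply/exists_inP; exists y => //; rewrite edge_sym.
by move=> u v; apply/idP/idP; exact: half.
Qed.

(** Remove from each S v its overlaps with the other neighbourhoods and the sets Z that disconnect
    the pairs, at most r(2M + b) vertices. The remainders are pairwise separated and, by [h2], too
    large in total for alpha(W). *)
Lemma unlinked_bound X : X \subset J -> #|X| = r ->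
  {in X &, forall u v, u != v -> #|S u :&: nb v| < b} ->
  {in X &, forall u v, u != v -> ~~ linked u v} -> False.
Proof.
move=> XJ cX hb hl.
have /choice[Zf hZf] : forall p : G * G, exists Z : {set G}, #|Z| <= M /\
    (p.1 \in X -> p.2 \in X -> p.1 != p.2 ->
     forall y z, y \in S p.1 :\: Z -> z \in S p.2 :\: Z -> ~~ edge y z).
  move=> [u v] /=.
  have [/and3P[uX vX uv]|] := boolP [&& u \in X, v \in X & u != v]; last first.
    by move=> hn; exists set0; rewrite cards0; split=> // *; case/negP: hn; apply/and3P.
  have /forallPn[Z] := hl u v uX vX uv.
  rewrite negb_imply => /andP[ZM /exists_inPn h]; exists Z; split=> // _ _ _ y z yS zS.
  by have /exists_inPn/(_ z zS) := h y yS.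
pose rm v := \bigcup_(u in X) (Zf (u, v) :|: Zf (v, u) :|:
  (if u == v then set0 else S v :&: nb u)).
have crm v : v \in X -> #|rm v| <= r * (2 * M + b).
  move=> vX; rewrite -cX; apply: card_bigcup_leq => u uX.
  apply: leq_trans (leq_card_setU _ _) _; apply: leq_add.
    apply: leq_trans (leq_card_setU _ _) _; rewrite mul2n -addnn.
    by apply: leq_add; have [] := hZf (u, v); have [] := hZf (v, u).
  case: eqVneq => [_|uv]; first by rewrite cards0.
  by apply: ltnW; apply: hb; rewrite // eq_sym.
pose S' v := S v :\: rm v.
have hS' u v : u \in X -> v \in X -> u != v -> sep (S' u) (S' v).
  move=> uX vX uv; apply/sepP => x y /setDP[xS xr] /setDP[yS yr]; split.
    apply: contraNneq xr => E; apply/bigcupP; exists v => //.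
    rewrite (negbTE (_ : v != u)) 1?eq_sym // !in_setU in_setI xS E.
    by rewrite (subsetP (Snb (subsetP XJ v vX))) ?orbT // -E.
  have [_ /(_ uX vX uv)] := hZf (u, v); apply; rewrite in_setD.
    rewrite xS andbT; apply: contra xr => h; apply/bigcupP; exists v => //.
    by rewrite !in_setU h orbT.
  rewrite yS andbT; apply: contra yr => h; apply/bigcupP; exists u => //.
  by rewrite !in_setU h.
have := @card_sum_sep (enum X) S' (enum_uniq _).
have -> : \sum_(v <- enum X) #|S' v| = \sum_(v in X) #|S' v|.
  by rewrite big_enum.
have hlow : \sum_(v in X) #|S' v| >= r * (sg - r * (2 * M + b)).
  rewrite -cX -sum_nat_const cX; apply: leq_sum => v vX.
  have := cS (subsetP XJ v vX); have := crm v vX.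
  have := leq_card_setU (S v :\: rm v) (rm v) => /leqifP.
  have hsub : #|S v| <= #|S v :\: rm v| + #|rm v|.
    apply: leq_trans (leq_card_setU _ _); apply: subset_leq_card.
    by apply/subsetP => x xS; rewrite !inE xS andbT orNb.
  by move: hsub; rewrite /S'; clear; lia.
move=> h; have : \sum_(v in X) #|S' v| <= a.
  apply: leq_trans (h _ _) _.
  - move=> v; rewrite mem_enum => vX; apply: indepS (subsetDl _ _) _.
    by apply: iS; exact: (subsetP XJ).
  - by move=> u v; rewrite !mem_enum; exact: hS'.
  - apply: leq_trans alphaW; apply: alphaS; rewrite big_enum /=.
    apply/bigcupsP => v vX; apply: subset_trans (subsetDl _ _) _.
    by apply: SW; exact: (subsetP XJ).
move/(leq_trans hlow); rewrite mulnBr leq_subLR => h'.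
by move: h2; rewrite ltnNge => /negP; apply; rewrite addnC.
Qed.

Section Greedy.
Variable X : {set G}.
Hypothesis XJ : X \subset J.
Hypothesis cX : #|X| = 2 * t.
Hypothesis thin : {in X &, forall u v, u != v -> #|S u :&: nb v| < b}.
Hypothesis lk : {in X &, forall u v, u != v -> linked u v}.

(* The last clause keeps later picks easy: [y] spoils few vertices elsewhere.    *)
Let private x y := [&& y \in S x,
  [forall x' in X, (x' != x) ==> ~~ edge x' y] &
  [forall x' in X, (x' != x) ==> (#|S x' :&: nb y| < b)]].

(** The edges are chosen one pair at a time. At most M vertices are forbidden to the next choice, so
    [linked] still provides an edge. *)
Lemma greedy_picks (l : seq (G * G)) : size l <= t ^ 2 ->
  (forall p, p \in l -> [/\ p.1 \in X, p.2 \in X & p.1 != p.2]) ->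
  exists f : G * G -> G * G,
    (forall p, p \in l -> [/\ private p.1 (f p).1, private p.2 (f p).2
                            & edge (f p).1 (f p).2]) /\
    {in l &, forall p q, p != q ->
       [/\ ~~ edge (f p).1 (f q).1, ~~ edge (f p).1 (f q).2
         & ~~ edge (f p).2 (f q).2]}.
Proof.
elim: l => [|p l IH] sl hl; first by exists id.
have [|q ql|f [hf1 hf2]] := IH; first exact: ltnW.
  by apply: hl; rewrite inE ql orbT.
have [pl|pl] := boolP (p \in l).
  by exists f; split=> [q|q q']; rewrite !inE => /predU1P[->|?];
     [exact: hf1 | exact: hf1 | move=> /predU1P[->|?]; exact: hf2 | move=> /predU1P[->|?]; exact: hf2].
have [p1X p2X p12] := hl p (mem_head _ _).
(* Forbidden are vertices adjacent to a second member of X, vertices with many neighbours in another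
   S x', and neighbours of earlier picks. *)
pose Z1 := \bigcup_(x in X) \bigcup_(x' in X)
  (if x' == x then set0 else S x :&: nb x').
pose Z2 := \bigcup_(x in X) \bigcup_(x' in X)
  (if x' == x then set0 else [set y in S x | b <= #|S x' :&: nb y|]).
pose Z3 := \bigcup_(q <- l) \bigcup_(x in X)
  (S x :&: nb (f q).1 :|: S x :&: nb (f q).2).
have c1 : #|Z1| <= 4 * t ^ 2 * b.
  apply: (@leq_trans (#|X| * (#|X| * b))); last by rewrite cX; clear; nia.
  apply: card_bigcup_leq => x xX; apply: card_bigcup_leq => x' x'X.
  case: eqVneq => [_|n]; first by rewrite cards0.
  by apply: ltnW; apply: thin; rewrite // eq_sym.
have c2 : #|Z2| <= 4 * t ^ 2 * d.
  apply: (@leq_trans (#|X| * (#|X| * d))); last by rewrite cX; clear; nia.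
  apply: card_bigcup_leq => x xX; apply: card_bigcup_leq => x' x'X.
  case: eqVneq => [_|n]; first by rewrite cards0.
  have xJ := subsetP XJ x xX; have x'J := subsetP XJ x' x'X.
  apply/ltnW/(@few_heavy a b d _ (S x')); auto.
    by apply: indepS (iS xJ); apply/subsetP => y; rewrite inE => /andP[].
  by move=> y; rewrite inE => /andP[].
have own x y : x \in X -> private x y -> forall x', x' \in X -> #|S x' :&: nb y| <= b.
  move=> xX /and3P[yS _ /forall_inP h] x' x'X.
  have [->|n] := eqVneq x' x; last by have /implyP/(_ n)/ltnW := h x' x'X.
  rewrite (_ : S x :&: nb y = set0) ?cards0 //; apply/setP => z; rewrite !inE.
  apply/negP => /andP[zS e]; have /indepP/(_ y z yS zS) := iS (subsetP XJ x xX).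
  by rewrite e.
have hfb q : q \in l -> forall x, x \in X ->
    #|S x :&: nb (f q).1| <= b /\ #|S x :&: nb (f q).2| <= b.
  move=> ql x xX; have [g1 g2 _] := hf1 q ql.
  have [q1 q2 _] : [/\ q.1 \in X, q.2 \in X & q.1 != q.2].
    by apply: hl; rewrite inE ql orbT.
  by split; [exact: own g1 _ xX | exact: own g2 _ xX].
have c3 : #|Z3| <= 4 * t ^ 3 * b.
  apply: (@leq_trans (size l * (#|X| * (b + b)))); last first.
    by move: sl; rewrite cX /=; clear; nia.
  rewrite /Z3; elim: (l) hfb => [|q l' IHl] hq; first by rewrite big_nil cards0.
  rewrite big_cons mulSn; apply: leq_trans (leq_card_setU _ _) _.
  apply: leq_add; last by apply: IHl => q' ql'; apply: hq; rewrite inE ql' orbT.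
  apply: card_bigcup_leq => x xX; apply: leq_trans (leq_card_setU _ _) _.
  by have [? ?] := hq q (mem_head _ _) x xX; exact: leq_add.
have cZ : #|Z1 :|: Z2 :|: Z3| <= M.
  apply: leq_trans h3; apply: leq_trans (leq_card_setU _ _) _.
  apply: leq_add => //; apply: leq_trans (leq_card_setU _ _) _.
  by rewrite mulnDr; exact: leq_add.
have [y [z [/setDP[yS yZ] /setDP[zS zZ] e]]] := linkedP (lk p1X p2X p12) cZ.
have priv x u : x \in X -> u \in S x -> u \notin Z1 :|: Z2 :|: Z3 -> private x u.
  move=> xX uS; rewrite !in_setU !negb_or => /andP[/andP[uZ1 uZ2] _].
  apply/and3P; split=> //; apply/forall_inP => x' x'X; apply/implyP => n.
    apply: contra uZ1 => e'; apply/bigcupP; exists x => //; apply/bigcupP.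
    by exists x'; rewrite // (negbTE n) !inE uS.
  rewrite ltnNge; apply: contra uZ2 => hb; apply/bigcupP; exists x => //.
  by apply/bigcupP; exists x'; rewrite // (negbTE n) !inE uS.
have away x u q : x \in X -> u \in S x -> u \notin Z1 :|: Z2 :|: Z3 -> q \in l ->
    ~~ edge (f q).1 u /\ ~~ edge (f q).2 u.
  move=> xX uS; rewrite !in_setU !negb_or => /andP[_ uZ3] ql.
  have hq : \bigcup_(x in X) (S x :&: nb (f q).1 :|: S x :&: nb (f q).2) \subset Z3.
    by rewrite /Z3 (big_rem q) //= subsetUl.
  split; apply: contra uZ3 => e'; apply: (subsetP hq); apply/bigcupP; exists x => //;
    by rewrite !inE uS e' ?orbT.
exists (fun q => if q == p then (y, z) else f q).
have np q : q \in l -> (q == p) = false.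
  by move=> ql; apply: contraNF pl => /eqP<-.
split=> [q|q q']; rewrite !inE.
  by case/predU1P => [->|ql]; [rewrite eqxx | rewrite (np _ ql); exact: hf1]; split=> //; exact: priv.
case/predU1P => [->|ql] /predU1P[->|ql']; rewrite ?eqxx ?np //= => n.
- have [? ?] := away _ _ _ p1X yS yZ ql'; have [? ?] := away _ _ _ p2X zS zZ ql'.
  by split; rewrite edge_sym.
- have [? ?] := away _ _ _ p1X yS yZ ql; have [? ?] := away _ _ _ p2X zS zZ ql.
  by [].
- exact: hf2.
Qed.

(** Split X into halves of size t. Each member and its picks form a star, and every picked edge
    joins stars of different halves. Within a half, privacy and the non-adjacency of picks keep the
    stars separated. *)
Lemma linked_clique_model : False.
Proof.
apply: nomodel.
pose la := take t (enum X); pose lb := drop t (enum X).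
have cl : size (enum X) = 2 * t by rewrite -cardE.
have sa : size la = t by rewrite size_takel // cl; lia.
have sb : size lb = t by rewrite size_drop cl; lia.
have ab : [/\ uniq la, uniq lb & ~~ has (mem la) lb].
  by have := enum_uniq X; rewrite -(cat_take_drop t (enum X)) cat_uniq => /and3P[].
have [ula ulb dab] := ab.
have aX x : x \in la -> x \in X by move/mem_take; rewrite mem_enum.
have bX x : x \in lb -> x \in X by move/mem_drop; rewrite mem_enum.
have nab x u : x \in la -> u \in lb -> x != u.
  move=> xa ub; apply: contra dab => /eqP E; apply/hasP; exists u => //=.
  by rewrite -E.
have [|p|f [hf1 hf2]] := @greedy_picks [seq (x, u) | x <- la, u <- lb].
- by rewrite size_allpairs sa sb mulnn.
- by case/allpairsP => q [q1 q2 ->] /=; split; [exact: aX | exact: bX | exact: nab].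
have pin x u : x \in la -> u \in lb -> (x, u) \in [seq (x, u) | x <- la, u <- lb].
  by move=> xa ub; apply: allpairs_f.
pose y x u := (f (x, u)).1; pose z x u := (f (x, u)).2.
pose A x := x |: [set y x u | u in lb].
pose B u := u |: [set z x u | x in la].
have iX x x' : x \in X -> x' \in X -> ~~ edge x x'.
  by move=> xX x'X; have /indepP := iJ; apply; exact: (subsetP XJ).
have pr1 x u : x \in la -> u \in lb -> private x (y x u).
  by move=> xa ub; have [] := hf1 _ (pin x u xa ub).
have pr2 x u : x \in la -> u \in lb -> private u (z x u).
  by move=> xa ub; have [] := hf1 _ (pin x u xa ub).
have yz x u : x \in la -> u \in lb -> edge (y x u) (z x u).
  by move=> xa ub; have [] := hf1 _ (pin x u xa ub).
have prE x v : x \in X -> private x v -> edge x v.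
  move=> xX /and3P[vS _ _].
  by have := subsetP (Snb (subsetP XJ x xX)) v vS; rewrite inE.
have prN x v x' : private x v -> x' \in X -> x' != x -> ~~ edge x' v.
  by move=> /and3P[_ /forall_inP h _] x'X n; exact: (implyP (h x' x'X)).
have neq x v x' v' : x \in X -> x' \in X -> x != x' -> private x v -> private x' v' ->
    v != v'.
  move=> xX x'X n h h'; apply: contraTneq (prE x v xX h) => ->.
  exact: prN h' xX n.
have neqX x v x' : x \in X -> x' \in X -> private x v -> x' != v.
  by move=> xX x'X h; apply: contraTneq (prE x v xX h) => <-; exact: iX.
have star (c : G) (s : seq G) (g : G -> G) : (forall u, u \in s -> edge c (g u)) ->
    conn (c |: [set g u | u in s]).
  move=> h; apply: (@conn_from _ _ c); first by rewrite !inE eqxx.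
  move=> v /setU1P[->//|/imsetP[u us ->]]; apply: connect1.
  by rewrite /inside !inE eqxx imset_f ?orbT //= h.
have sep_stars (c c' : G) (s s' : seq G) (g g' : G -> G) : c \in X -> c' \in X -> c != c' ->
    (forall u, u \in s -> private c (g u)) -> (forall u, u \in s' -> private c' (g' u)) ->
    (forall u u', u \in s -> u' \in s' -> ~~ edge (g u) (g' u')) ->
    sep (c |: [set g u | u in s]) (c' |: [set g' u | u in s']).
  move=> cX' c'X n h h' hg; apply/sepP => v v' /setU1P[->|/imsetP[u us ->]].
    move=> /setU1P[->|/imsetP[u' us' ->]]; split=> //.
    - exact: iX.
    - exact: neqX c'X cX' (h' _ us').
    - exact: prN (h' _ us') cX' n.
  move=> /setU1P[->|/imsetP[u' us' ->]]; split.
  - by rewrite eq_sym; exact: neqX cX' c'X (h _ us).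
  - by rewrite edge_sym; apply: prN (h _ us) c'X _; rewrite eq_sym.
  - exact: neq n (h _ us) (h' _ us').
  - exact: hg.
exists (map A la), (map B lb); split; rewrite ?size_map //; split.
- apply/allP => _ /mapP[x xa ->]; apply: star => u ub; apply: prE; auto.
- by apply/allP => _ /mapP[u ub ->]; apply: star => x xa; apply: prE; auto.
- rewrite pairwise_map.
  apply: (@sub_in_pairwise _ (mem la) (fun x y => x != y)).
  + move=> x x' /= xa xa' n; apply: sep_stars; auto.
    move=> u u' ub ub'; have [] // := hf2 _ _ (pin x u xa ub) (pin x' u' xa' ub').
    by rewrite xpair_eqE (negbTE n).
  + exact/allP.
  + by rewrite -uniq_pairwise.
- rewrite pairwise_map.
  apply: (@sub_in_pairwise _ (mem lb) (fun x y => x != y)).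
  + move=> u u' /= ub ub' n; apply: sep_stars; auto.
    move=> x x' xa xa'; have [] // := hf2 _ _ (pin x u xa ub) (pin x' u' xa' ub').
    by rewrite xpair_eqE (negbTE n) andbF.
  + exact/allP.
  + by rewrite -uniq_pairwise.
- move=> _ _ /mapP[x xa ->] /mapP[u ub ->]; split.
    have n := nab x u xa ub.
    apply/pred0P => v /=; apply/negP => /andP[/setU1P[->|/imsetP[u' ub' ->]]].
      move=> /setU1P[E|/imsetP[x' xa' E]]; first by rewrite E eqxx in n.
      by have := neqX u (z x' u) x (bX _ ub) (aX _ xa) (pr2 _ _ xa' ub); rewrite E eqxx.
    move=> /setU1P[E|/imsetP[x' xa' E]].
      by have := neqX x (y x u') u (aX _ xa) (bX _ ub) (pr1 _ _ xa ub'); rewrite E eqxx.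
    by have := neq _ _ _ _ (aX _ xa) (bX _ ub) n (pr1 _ _ xa ub') (pr2 _ _ xa' ub); rewrite E eqxx.
  apply/nsepP; exists (y x u), (z x u); split.
  + by apply/setU1P; right; exact: imset_f.
  + by apply/setU1P; right; apply/imsetP; exists x.
  + by rewrite yz ?orbT.
Qed.

End Greedy.

(** Overlapping in at least b vertices is a relation of out-degree below d, so a large part of J has
    small overlaps. There Ramsey gives 2t pairwise linked or r pairwise unlinked vertices, both
    impossible. *)
Lemma dense_model : False.
Proof.
have outdeg v : v \in J -> #|[set u in J | b <= #|S v :&: nb u|]| < d.
  move=> vJ; apply: (@few_heavy a b d _ (S v)); auto.
    by apply: indepS iJ; apply/subsetP => u; rewrite inE => /andP[].
  by move=> u; rewrite inE => /andP[].
have [J' [J'J cJ' hJ']] := sparse_digraph_stable d0 outdeg.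
have thin : {in J' &, forall u v, u != v -> #|S u :&: nb v| < b}.
  by move=> u v uJ vJ n; rewrite ltnNge; exact: hJ'.
have big : r ^ (2 * t) <= #|J'|.
  have := leq_trans h4 cJ'; rewrite leq_pmul2l //; lia.
case: (ramsey linkedC r0 big) => [] [X [XJ' cX hX]].
  apply: (@linked_clique_model X) => //; first exact: subset_trans J'J.
  by move=> u v uX vX; apply: thin; exact: (subsetP XJ').
apply: (@unlinked_bound X) => //; first exact: subset_trans J'J.
by move=> u v uX vX; apply: thin; exact: (subsetP XJ').
Qed.

End Dense.

(** Otherwise an optimal independent set contains more than alpha/(2p) vertices of degree at least
    alpha/(2p), because the others account for at most half of alpha^2/p. Maximum independent sets
    in their neighbourhoods then fulfil the hypotheses of [dense_model]. *)
Theorem a_priori (W : {set G}) p : 0 < t -> 0 < p ->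
  (2000 * t ^ 4 * p ^ 2) ^ (2 * t).+2 < alpha W ->
  p * walpha (deg W) W <= alpha W ^ 2.
Proof.
move=> t0 p0.
(* With b about a/beta and [sg] about a/(2p), r = 5p makes r sg about 5a/2, while beta keeps r^2 (2M
   + b) at most 5a/4, as [h2] requires. For [h1], d = 4 t beta makes d b about 4ta. *)
have [beta betaE] : exists beta, beta = 500 * p ^ 2 * t ^ 3 by eexists.
have [r rE] : exists r, r = 5 * p by eexists.
have -> : 2000 * t ^ 4 * p ^ 2 = 4 * t * beta by rewrite betaE; lia.
have beta0 : 0 < beta by rewrite betaE !(muln_gt0, expn_gt0) t0 p0.
have pbeta : 500 * p <= beta.
  rewrite betaE -mulnA leq_mul2l; apply/orP; right; rewrite -mulnn -mulnA leq_pmulr //.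
  by rewrite muln_gt0 p0 expn_gt0 t0.
have [d dE] : exists d, d = 4 * t * beta by eexists.
have betad : 4 * beta <= d by rewrite dE mulnAC leq_pmulr.
have dpos : 0 < d by lia.
rewrite -dE; set a := alpha W => da.
rewrite leqNgt; apply/negP => big.
have [I [IW iI sI]] := walpha_ex (deg W) W.
pose J := [set v in I | a <= 2 * p * deg W v].
have JI : J \subset I by apply/subsetP => v; rewrite inE => /andP[].
have degle v : deg W v <= a by apply: alphaS; exact: subsetIr.
have cJ : a < 2 * p * #|J|.
  have hJ : \sum_(v in J) deg W v <= #|J| * a.
    by rewrite -sum_nat_const; apply: leq_sum.
  have hIJ : 2 * p * \sum_(v in I :\: J) deg W v <= a * a.
    rewrite big_distrr /=; apply: (@leq_trans (\sum_(v in I :\: J) a)).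
      apply: leq_sum => v; rewrite !inE => /andP[+ vI]; rewrite vI -ltnNge.
      exact: ltnW.
    rewrite sum_nat_const leq_mul2r; apply/orP; right.
    by apply: leq_trans (alpha_ge IW iI); apply: subset_leq_card; exact: subsetDl.
  have E : walpha (deg W) W = \sum_(v in J) deg W v + \sum_(v in I :\: J) deg W v.
    by rewrite -sI (big_setID J) /= (setIidPr JI).
  rewrite E in big; move: big hJ hIJ; set s1 := \sum_(v in J) _.
  set s2 := \sum_(v in _ :\: _) _; clear; nia.
have /choice[S hS] : forall v, exists Z : {set G},
    [/\ Z \subset nbh [set v] :&: W, indep Z & #|Z| = deg W v].
  by move=> v; exact: alpha_ex.
have hd : d ^ 2 <= a by apply: leq_trans (ltnW da); rewrite leq_pexp2l.
have d1 : d ^ t.+1 <= a.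
  by apply: leq_trans (ltnW da); rewrite leq_pexp2l //; clear; lia.
have d2 : 4 * p * d * r ^ (2 * t) <= a.
  apply: leq_trans (ltnW da); rewrite !expnS mulnA leq_mul //.
    by rewrite leq_mul2r; apply/orP; right; clear -pbeta betad; lia.
  by rewrite leq_exp2r ?muln_gt0 //; clear -rE pbeta betad; lia.
have [b bE] : exists b, b = a %/ beta by eexists.
have b1 : beta * b <= a by rewrite bE mulnC leq_divM.
have b2 : a < beta * b.+1 by rewrite bE mulnC ltn_ceil.
have [sg sgE] : exists sg, sg = a %/ (2 * p) by eexists.
have sg1 : a < 2 * p * sg.+1 by rewrite sgE mulnC ltn_ceil // muln_gt0.
have betada : beta * d <= a.
  by apply: leq_trans hd; rewrite -mulnn leq_mul2r; apply/orP; right; clear -betad; lia.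
have db : d <= b by rewrite bE leq_divRL // mulnC.
have t32 : t ^ 2 <= t ^ 3 by rewrite leq_pexp2l.
have [M ME] : exists M, M = 4 * t ^ 2 * (b + d) + 4 * t ^ 3 * b by eexists.
have hM : 2 * M + b <= 25 * t ^ 3 * b.
  have : b <= t ^ 3 * b by rewrite leq_pmull // expn_gt0 t0.
  have : t ^ 2 * b <= t ^ 3 * b by rewrite leq_mul2r t32 orbT.
  have : t ^ 2 * d <= t ^ 2 * b by rewrite leq_mul2l db orbT.
  by rewrite ME; clear; lia.
have hrM : 4 * (r * (r * (2 * M + b))) <= 5 * a.
  apply: (@leq_trans (4 * (r * (r * (25 * t ^ 3 * b))))).
    by rewrite !leq_mul2l hM !orbT.
  apply: (@leq_trans (5 * (beta * b))); last by rewrite leq_mul2l b1.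
  by rewrite rE betaE; clear; lia.
have a500 : 500 * p <= a by apply: leq_trans pbeta (leq_trans _ betada); rewrite leq_pmulr.
apply: (@dense_model W J S a b d r M sg) => //.
- exact: indepS iI.
- by move=> v _; have [h _ _] := hS v; apply: subset_trans h (subsetIr _ _).
(* If S v contained v, it would be the singleton of v, too small for the degree of v. *)
- move=> v; rewrite inE => /andP[vI av]; have [h iS cS] := hS v.
  apply/subsetP => u uS; rewrite inE.
  have := subsetP h u uS; rewrite inE nbh1 => /andP[/predU1P[E|//] _].
  have : #|S v| <= #|[set v]|.
    apply: subset_leq_card; apply/subsetP => x xS; rewrite inE.
    have := subsetP h x xS; rewrite inE nbh1 => /andP[/orP[//|e] _].
    by have /indepP/(_ u x uS xS) := iS; rewrite E e.
  rewrite cS cards1 => h1.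
  have := leq_mul (leqnn (2 * p)) h1.
  by move: av a500 p0; clear; lia.
- by move=> v _; have [] := hS v.
- move=> v; rewrite inE => /andP[vI av]; have [h iS ->] := hS v.
  rewrite sgE -(leq_pmul2l (_ : 0 < 2 * p)); last by rewrite muln_gt0.
  by apply: leq_trans av; rewrite mulnC leq_divM.
- have e1 : t * d ^ t.+1 <= t * a by rewrite leq_mul2l d1 orbT.
  have e2 : t * a < t * (beta * b + beta) by rewrite ltn_pmul2l // -mulnSr.
  have e3 : t * (beta * 4) <= t * a.
    rewrite leq_mul2l; apply/orP; right; apply: leq_trans betada.
    by rewrite leq_mul2l; apply/orP; right; clear -betad beta0; lia.
  by move: e1 e2 e3; rewrite dE; clear; lia.
- have h1 : 5 * a < 10 * p * sg.+1 by move: sg1; clear; lia.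
  by move: hrM a500 h1 p0; rewrite (_ : r * sg = 5 * p * sg) ?rE //; clear; lia.
- by rewrite ME.
- rewrite -(leq_pmul2l (_ : 0 < 2 * p)); last by rewrite muln_gt0.
  apply: leq_trans (ltnW cJ); apply: leq_trans d2; apply: eq_leq; clear; lia.
Qed.
End APriori.

(** * Independent sets have nearly linear total degree *)

Section Density.
Variables (G : sgraph) (t : nat).
Hypothesis nomodel : ~ biclique_model G t.
Implicit Types (Q W X Y Z S : {set G}).

(** Take a union X of components, maximal with alpha at most 3a/4. If the rest had more than 3a/4,
    then X would have less than a/4, leaving room for one more component of at most a/2. *)
Lemma balanced_split Y a : alpha Y <= a ->
  (forall Q, conn Q -> Q \subset Y -> 2 * alpha Q <= a) ->
  exists X, [/\ X \subset Y, sep X (Y :\: X), 4 * alpha X <= 3 * a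
               & 4 * alpha (Y :\: X) <= 3 * a].
Proof.
move=> Ya hQ.
pose p X := [&& X \subset Y, sep X (Y :\: X) & 4 * alpha X <= 3 * a].
have p0 : p set0 by rewrite /p sub0set sep0l alpha0.
have [X maxX _] := maxset_exists p0.
have /and3P[XY sX aX] := maxsetp maxX.
exists X; split=> //; rewrite leqNgt; apply/negP => big.
have [v vYX] : exists v, v \in Y :\: X.
  by apply/set0Pn; apply: contraTneq big => ->; rewrite alpha0.
have vY1 : [set v] \subset Y :\: X by rewrite sub1set.
have [D [cD vD DY nD]] := component_max (conn1 v) vY1.
rewrite sub1set in vD.
have h1 := alpha_sep sX XY (subsetDl Y X).
have h2 := hQ D cD (subset_trans DY (subsetDl Y X)).
have h3 := alphaU X D.
suff E : X :|: D = X by move: vYX; rewrite -E !inE vD orbT.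
apply: (maxsetsup maxX); last exact: subsetUl.
apply/and3P; split; last by move: h1 h2 h3 big Ya; clear; lia.
  by rewrite subUset XY (subset_trans DY) ?subsetDl.
rewrite sepUl; apply/andP; split.
  by apply: sepS sX => //; apply: setDS; exact: subsetUl.
rewrite sep_nbh; apply/pred0P => y /=; apply/negP => /andP[yD].
rewrite in_setD in_setU negb_or => /andP[/andP[yX /negP yD'] yY]; apply: yD'.
by apply: (subsetP nD); rewrite in_setI yD in_setD yX.
Qed.

Lemma deg_leq W v : deg W v <= alpha W.
Proof. by apply: alphaS; exact: subsetIr. Qed.

Lemma walpha_deg_leq W : walpha (deg W) W <= alpha W * alpha W.
Proof. by apply: walpha_leq => v _; rewrite muln1 deg_leq. Qed.

(** A vertex of X has all its neighbours in X and S, and likewise for Z; the degree of a vertex of S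
    is at most the sum of its degrees on the two sides. *)
Lemma walpha_deg_split X S Z : sep X Z ->
  walpha (deg (X :|: S :|: Z)) (X :|: S :|: Z)
    <= walpha (deg (X :|: S)) (X :|: S) + walpha (deg (Z :|: S)) (Z :|: S).
Proof.
move=> sXZ; set W := _ :|: Z.
have [I [IW iI <-]] := walpha_ex (deg W) W.
have part Y : \sum_(v in I) (if v \in Y then deg Y v else 0) <= walpha (deg Y) Y.
  rewrite -big_mkcondr; apply: leq_trans (walpha_ge (deg Y) (subsetIr I Y) _).
    by apply: eq_leq; apply: eq_bigl => v; rewrite inE.
  by apply: indepS iI; exact: subsetIl.
apply: leq_trans (leq_add (part _) (part _)); rewrite -big_split /=.
apply: leq_sum => v vI; have vW := subsetP IW v vI.
have far x y : x \in X -> y \in Z -> [/\ x != y, y != x, ~~ edge x y & ~~ edge y x].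
  move=> xX yZ; have /sepP/(_ x y xX yZ)[n e] := sXZ.
  by split; rewrite // 1?eq_sym // edge_sym.
have nX y : v \in X -> y \in nbh [set v] -> y \in Z = false.
  move=> vX; rewrite nbh1 => h; apply/negP => yZ.
  by have [_ /negbTE n /negbTE e _] := far v y vX yZ; rewrite n e in h.
have nZ y : v \in Z -> y \in nbh [set v] -> y \in X = false.
  move=> vZ; rewrite nbh1 => h; apply/negP => yX.
  by have [/negbTE n _ _ /negbTE e] := far y v yX vZ; rewrite n e in h.
have dXS : v \in X -> deg W v <= deg (X :|: S) v.
  move=> vX; apply: alphaS; apply/subsetP => y /setIP[yn].
  by rewrite in_setU nX // orbF => yXS; rewrite in_setI yn.
have dZS : v \in Z -> deg W v <= deg (Z :|: S) v.
  move=> vZ; apply: alphaS; apply/subsetP => y /setIP[yn].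
  by rewrite !in_setU nZ //= orbC => yZS; rewrite in_setI yn in_setU.
move: vW; rewrite !in_setU -orbA => /or3P[vX|vS|vZ].
- by rewrite vX; apply: leq_trans (dXS vX) (leq_addr _ _).
- rewrite vS !orbT; apply: leq_trans (alphaU _ _); apply: alphaS.
  apply/subsetP => y /setIP[yn]; rewrite !in_setU !in_setI yn !in_setU.
  by case: (y \in X); case: (y \in S); case: (y \in Z).
- by rewrite vZ; apply: leq_trans (dZS vZ) (leq_addl _ _).
Qed.

Variable l : nat.
Hypothesis t0 : 0 < t.
Hypothesis l0 : 0 < l.
Hypothesis cG : #|G| <= 2 ^ l.

Lemma alpha_leq_pow W : alpha W <= 2 ^ l.
Proof. by apply: leq_trans (alpha_card W) (leq_trans (max_card _) cG). Qed.

(** [separator] is used with K = l and J = 2l + 1, the latter because total degrees are at most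
    alpha^2 <= 2^(2l); [balanced_split] then groups the components. *)
Lemma separation W T : 0 < T -> T <= 2 ^ l ->
  exists X S Z, [/\ W = X :|: S :|: Z, sep X Z, [disjoint S & X :|: Z],
    4 * alpha X <= 3 * alpha W /\ 4 * alpha Z <= 3 * alpha W
    & T * alpha S <= 9 * l * walpha (deg W) W + 32 * t ^ 2 * l * T ^ 2].
Proof.
move=> T0 Tl.
have hJ : walpha (deg W) W < 2 ^ (2 * l + 1).
  apply: leq_ltn_trans (walpha_deg_leq W) _.
  apply: leq_ltn_trans (leq_mul (alpha_leq_pow W) (alpha_leq_pow W)) _.
  by rewrite -expnD ltn_exp2l // addnn -mul2n addn1.
have [S [SW hS hQ]] := separator nomodel Tl hJ.
have [X [XY sX aX aZ]] := balanced_split (alphaS (subsetDl W S)) hQ.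
exists X, S, ((W :\: S) :\: X); split=> //.
- have XW := subset_trans XY (subsetDl W S).
  apply/setP => v; rewrite !inE; have := subsetP XW v; have := subsetP SW v.
  by case: (v \in X) => [_ ->|] //; case: (v \in S) => // ->.
- rewrite disjoint_sym; apply: disjointWl (_ : _ \subset W :\: S) _.
    by rewrite subUset XY subsetDl.
  by rewrite -setI_eq0 setDE -setIA (setIC (~: S)) setICr setI0.
- apply: leq_trans hS _; apply: leq_add; first by rewrite leq_mul2r; apply/orP; right; move: l0; clear; lia.
  have h1 : 1 <= t * l by rewrite muln_gt0 t0.
  have h2 : t <= t * l by rewrite leq_pmulr.
  apply: (@leq_trans (T * (2 * t * (T * (16 * (t * l)))))); last by apply: eq_leq; clear; lia.
  rewrite !leq_mul2l; apply/orP; right; apply/orP; right.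
  apply: (@leq_trans (T * (1 + t * (8 * l + 7)))); first by apply: eq_leq; clear; lia.
  by rewrite leq_mul2l; apply/orP; right; move: h1 h2; clear; lia.
Qed.

(** With T about alpha/[step_const], both terms of [separation], divided by T, become at most
    alpha/(48 l): [step_const] controls the term in T^2, and [gap_const], taken as p in [a_priori],
    the degree term. From alpha = [dens_const] on, [a_priori] applies. *)
Definition step_const := 1536 * t ^ 2 * l ^ 2.
Definition gap_const := 864 * step_const * l ^ 2.
Definition dens_const := ((2000 * t ^ 4 * gap_const ^ 2) ^ (2 * t).+2).+1.

Let q0 : 0 < step_const.
Proof. by rewrite !(muln_gt0, expn_gt0) t0 l0. Qed.

Let p0 : 0 < gap_const.
Proof. by rewrite !(muln_gt0, expn_gt0) t0 l0. Qed.

Lemma small_separation W : dens_const <= alpha W ->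
  exists X S Z, [/\ W = X :|: S :|: Z, sep X Z,
    4 * alpha X <= 3 * alpha W /\ 4 * alpha Z <= 3 * alpha W
    & 24 * l * alpha S <= alpha W].
Proof.
move=> aW; have F := a_priori nomodel t0 p0 aW.
have qa : step_const <= alpha W.
  apply: leq_trans aW; rewrite /dens_const; apply: leqW.
  apply: (@leq_trans (2000 * t ^ 4 * gap_const ^ 2)).
    apply: (@leq_trans gap_const).
      by rewrite /gap_const mulnAC leq_pmull // !(muln_gt0, expn_gt0) l0.
    by rewrite -mulnn mulnA leq_pmull // !(muln_gt0, expn_gt0) t0 l0.
  by rewrite -[X in X <= _]expn1 leq_pexp2l // !(muln_gt0, expn_gt0) t0 l0.
have [q qE] : exists q, q = step_const by eexists.
have [a aE] : exists a, a = alpha W by eexists.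
move: F qa; rewrite /gap_const -qE -aE => F qa.
have [T TE] : exists T, T = a %/ q by eexists.
have hq : 0 < q by rewrite qE.
have T0 : 0 < T by rewrite TE divn_gt0.
have qT : q * T <= a by rewrite TE mulnC leq_divM.
have qT2 : a <= 2 * (q * T).
  have : a < q * T.+1 by rewrite TE mulnC ltn_ceil.
  have : q <= q * T by rewrite leq_pmulr.
  rewrite mulnS; clear; lia.
have Tl : T <= 2 ^ l by apply: leq_trans (alpha_leq_pow W); rewrite -aE TE leq_div.
have [X [S [Z [WE sXZ _ hXZ hS]]]] := separation W T0 Tl.
exists X, S, Z; split=> //; first by rewrite aE.
rewrite -(leq_pmul2l T0).
have h1 : 4 * q * (216 * l ^ 2 * walpha (deg W) W) <= 2 * q * (T * a).
  apply: (@leq_trans (a ^ 2)).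
    by apply: leq_trans F; apply: eq_leq; clear; lia.
  by rewrite -mulnn; apply: leq_trans (leq_mul qT2 (leqnn a)) _; apply: eq_leq; clear; lia.
have h2 : 2 * (216 * l ^ 2 * walpha (deg W) W) <= T * a.
  rewrite -(leq_pmul2l (_ : 0 < 2 * q)); last by rewrite muln_gt0.
  by apply: leq_trans h1; apply: eq_leq; clear; lia.
have h3 : T * (1536 * t ^ 2 * l ^ 2 * T) <= T * a.
  by rewrite -[_ * l ^ 2]/step_const -qE leq_mul2l qT orbT.
have h4 : 24 * l * (T * alpha S) <= 24 * l * (9 * l * walpha (deg W) W + 32 * t ^ 2 * l * T ^ 2).
  by rewrite leq_mul2l hS orbT.
move: h2 h3 h4; clear; move: (walpha _ _) (alpha S) => F s; rewrite -!mulnn; lia.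
Qed.

(* The factor [8 * l - j] absorbs the relative loss 1 / (8 l) of each level.      *)
Lemma density_rec j W : j <= 4 * l -> alpha W * 4 ^ j <= dens_const * 5 ^ j ->
  (8 * l - j) * walpha (deg W) W <= 8 * l * dens_const * alpha W.
Proof.
have small i Y : alpha Y <= dens_const ->
    (8 * l - i) * walpha (deg Y) Y <= 8 * l * dens_const * alpha Y.
  move=> le; rewrite -mulnA leq_mul ?leq_subr //.
  by apply: leq_trans (walpha_deg_leq Y) _; rewrite leq_mul2r le orbT.
elim: j W => [|j IH] W jl hj; first by apply: small; rewrite !muln1 in hj.
have [le|gt] := leqP (alpha W) dens_const; first exact: small.
have [X [S [Z [WE sXZ [aX aZ] hS]]]] := small_separation (ltnW gt).
have s20 : 24 * alpha S <= alpha W.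
  by apply: leq_trans hS; rewrite leq_mul2r leq_pmulr ?orbT.
have piece Y : 4 * alpha Y <= 3 * alpha W ->
    (8 * l - j) * walpha (deg (Y :|: S)) (Y :|: S) <= 8 * l * dens_const * alpha (Y :|: S).
  move=> hY; apply: IH; first exact: ltnW.
  (* As 3/4 + 1/24 < 4/5, each level shrinks alpha by the factor 4/5 that the hypothesis on j
     counts. *)
  have h1 : 5 * alpha (Y :|: S) <= 4 * alpha W.
    by have := alphaU Y S; move: hY s20; clear; lia.
  rewrite -(leq_pmul2l (_ : 0 < 5)) // mulnA.
  apply: leq_trans (leq_mul h1 (leqnn (4 ^ j))) _.
  by move: hj; rewrite !expnS; clear; lia.
have h1 := piece X aX; have h2 := piece Z aZ.
have hF : walpha (deg W) W <= walpha (deg (X :|: S)) (X :|: S) + walpha (deg (Z :|: S)) (Z :|: S).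
  by rewrite {1 2}WE; exact: walpha_deg_split.
have hA : alpha (X :|: S) + alpha (Z :|: S) <= alpha W + 2 * alpha S.
  have XW : X \subset W by rewrite WE -setUA subsetUl.
  have ZW : Z \subset W by rewrite WE subsetUr.
  by have := alphaU X S; have := alphaU Z S; have := alpha_sep sXZ XW ZW; clear; lia.
have [y yE] : exists y, y = 8 * l - j.+1 by eexists.
have yS : 8 * l - j = y.+1 by rewrite yE; move: jl l0; clear; lia.
rewrite -yE; rewrite yS in h1 h2.
have [D DE] : exists D, D = 8 * l by eexists.
rewrite -!DE in h1 h2 *.
have yD : y < D by rewrite yE DE; move: l0; clear; lia.
have hD : D * (2 * alpha S) <= alpha W.
  by apply: leq_trans hS; rewrite DE; clear; lia.
move: hF hA h1 h2 hD yD; clear.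
move: (walpha (deg W) W) (walpha (deg (X :|: S)) _) (walpha (deg (Z :|: S)) _).
move: (alpha W) (alpha S) (alpha (X :|: S)) (alpha (Z :|: S)) dens_const.
move=> a s a1 a2 m F F1 F2 hF hA h1 h2 hD yD.
have e1 : y.+1 * F <= D * m * (a + 2 * s).
  apply: (@leq_trans (y.+1 * (F1 + F2))); first by rewrite leq_mul2l hF orbT.
  apply: (@leq_trans (D * m * (a1 + a2))); last by rewrite leq_mul2l hA orbT.
  by rewrite !mulnDr leq_add.
(* The excess 2 alpha(S) <= alpha(W)/D turns D into D + 1, which is absorbed by y (D + 1) <= (y + 1)
   D. *)
have e2 : y.+1 * F <= m * (D.+1 * a).
  apply: leq_trans e1 _; rewrite [D * m]mulnC -mulnA leq_mul2l mulnDr mulSn addnC.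
  by rewrite leq_add2r hD orbT.
have e3 : y * D.+1 <= y.+1 * D by move: yD; clear; lia.
rewrite -(leq_pmul2l (ltn0Sn y)).
apply: (@leq_trans (y * (m * (D.+1 * a)))).
  by rewrite mulnCA leq_mul2l e2 orbT.
apply: (@leq_trans (m * a * (y * D.+1))); first by apply: eq_leq; clear; lia.
apply: (@leq_trans (m * a * (y.+1 * D))); first by rewrite leq_mul2l e3 orbT.
by apply: eq_leq; clear; lia.
Qed.

(** Depth 4l suffices since (5/4)^4 > 2 and alpha <= 2^l; the factor 8l - 4l left on the degree side
    costs 2. *)
Theorem density W : walpha (deg W) W <= 2 * dens_const * alpha W.
Proof.
have hW : alpha W * 4 ^ (4 * l) <= dens_const * 5 ^ (4 * l).
  apply: (@leq_trans (1 * (5 ^ 4) ^ l)); last by rewrite -expnM leq_mul2r orbT.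
  apply: (@leq_trans (2 ^ l * (4 ^ 4) ^ l)).
    by rewrite -expnM leq_mul2r alpha_leq_pow orbT.
  by rewrite -expnMn mul1n leq_exp2r.
have := density_rec (leqnn _) hW.
have -> : 8 * l - 4 * l = 4 * l by clear; lia.
have -> : 8 * l = 4 * l * 2 by clear; lia.
by rewrite -!mulnA leq_pmul2l // leq_pmul2l.
Qed.

End Density.

(** * Tree decompositions *)

Section RootedTree.
Variables (T : finType) (r : T) (par : T -> T) (rk : T -> nat).
Hypothesis rk_par : forall x, x != r -> rk (par x) < rk x.

Definition par_edge : rel T :=
  fun x y => (x != r) && (par x == y) || (y != r) && (par y == x).

Fact par_edge_sym : symmetric par_edge.
Proof. by move=> x y; rewrite /par_edge orbC. Qed.

Fact par_edge_irr : irreflexive par_edge.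
Proof.
move=> x; rewrite /par_edge orbb; apply/negP => /andP[/rk_par + /eqP E].
by rewrite E ltnn.
Qed.

Definition par_tree : sgraph := SGraph par_edge_sym par_edge_irr.

Lemma par_edge_up x y : par_edge x y -> rk y <= rk x -> y = par x.
Proof.
by case/orP => /andP[n /eqP E] // le; have := rk_par n; rewrite E ltnNge le.
Qed.

(* On a cycle, both neighbours of a vertex of maximal rank are its parent.     *)
Lemma par_tree_is_tree : is_tree par_tree.
Proof.
split.
  split; first by apply/card_gt0P; exists r.
  have up x : connect (@edge par_tree) x r.
    have [n] := ubnP (rk x); elim: n x => // n IH x hn.
    have [->|xr] := eqVneq x r; first exact: connect0.
    apply: connect_trans (IH (par x) _); last by apply: leq_trans (rk_par xr) _.
    by apply: connect1; rewrite /= /par_edge xr eqxx.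
  move=> x y; apply: connect_trans (up x) _.
  by rewrite (sym_connect_sym (@edge_sym par_tree)) up.
move=> p szp /andP[cyc up].
have [x0 x0p] : exists x, x \in p by case: p szp {cyc up} => // x p _; exists x; rewrite mem_head.
pose x := [arg max_(x > x0 in p) rk x].
have [xp xmax] : x \in p /\ forall y, y \in p -> rk y <= rk x.
  by rewrite /x; case: arg_maxnP.
have [i q E] := rot_to xp.
have cyc' : cycle par_edge (x :: q) by rewrite -E rot_cycle.
have uq : uniq (x :: q) by rewrite -E rot_uniq.
have mq y : y \in q -> rk y <= rk x.
  by move=> yq; apply: xmax; rewrite -(mem_rot i) E inE yq orbT.
have : 2 < size (x :: q) by rewrite -E size_rot.
case: q cyc' uq mq {E} => [|y q] //; case/lastP: q => [|q z] // cyc' uq mq _.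
move: cyc'; rewrite /= !rcons_path last_rcons => /andP[xy /andP[_ zx]].
have Ey : y = par x by apply: par_edge_up xy (mq _ _); rewrite inE eqxx.
have Ez : z = par x.
  apply: par_edge_up (mq _ _); first by rewrite par_edge_sym.
  by rewrite inE mem_rcons inE eqxx orbT.
by move: uq; rewrite /= Ey Ez mem_rcons inE eqxx andbF.
Qed.

End RootedTree.

Section Decomposition.
Variable G : sgraph.
Implicit Types (W X Y Z S : {set G}).

(* Nodes point to their parents; the set of bags containing [v] is closed under *)
(* taking parents below its top node.                                           *)
Definition rooted_dec W k := exists (T : finType) (r : T) (par : T -> T)
    (rk : T -> nat) (chi : T -> {set G}),
  [/\ forall x, x != r -> rk (par x) < rk x,
      forall x, chi x \subset W /\ alpha (chi x) <= k,
      forall v, v \in W -> exists top, v \in chi top /\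
        forall x, v \in chi x -> x != top -> x != r /\ v \in chi (par x)
    & forall u v, u \in W -> v \in W -> edge u v ->
        exists x, u \in chi x /\ v \in chi x].

Lemma rooted_dec0 : rooted_dec set0 0.
Proof.
exists unit, tt, id, (fun=> 0), (fun=> set0); split=> [[]|||]; first by rewrite eqxx.
- by move=> _; rewrite sub0set alpha0.
- by move=> v; rewrite inE.
- by move=> u v; rewrite inE.
Qed.

(** Both trees hang below a new root [None] with bag S, and S is added to every bag. *)
Lemma rooted_dec_join X S Z k s : rooted_dec X k -> rooted_dec Z k ->
  sep X Z -> [disjoint S & X :|: Z] -> alpha S <= s ->
  rooted_dec (X :|: S :|: Z) (s + k).
Proof.
move=> [T1 [r1 [par1 [rk1 [chi1 [p1 a1 c1 e1]]]]]].
move=> [T2 [r2 [par2 [rk2 [chi2 [p2 a2 c2 e2]]]]]] sXZ dS aS.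
pose par (x : option (T1 + T2)) : option (T1 + T2) := match x with
  | None => None
  | Some (inl y) => if y == r1 then None else Some (inl (par1 y))
  | Some (inr y) => if y == r2 then None else Some (inr (par2 y)) end.
pose rk (x : option (T1 + T2)) := match x with
  | None => 0 | Some (inl y) => (rk1 y).+1 | Some (inr y) => (rk2 y).+1 end.
pose chi (x : option (T1 + T2)) : {set G} := match x with
  | None => S | Some (inl y) => chi1 y :|: S | Some (inr y) => chi2 y :|: S end.
have SX v : v \in X -> v \notin S.
  by move=> vX; apply/negP => vS; have /pred0P/(_ v) := dS; rewrite /= inE vS vX.
have SZ v : v \in Z -> v \notin S.
  by move=> vZ; apply/negP => vS; have /pred0P/(_ v) := dS; rewrite /= inE vS vZ orbT.
have Schi v x : v \in S -> v \in chi x.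
  by move=> vS; case: x => [[]|] /= *; rewrite ?inE vS ?orbT.
have top1 v : v \in X -> exists2 x, v \in chi1 x & true.
  by move=> /c1[x [vx _]]; exists x.
have top2 v : v \in Z -> exists2 x, v \in chi2 x & true.
  by move=> /c2[x [vx _]]; exists x.
have XZ v : v \in X -> v \in Z -> False by exact: sep_disj.
exists (option (T1 + T2)), None, par, rk, chi; split.
- case=> [[x|x]|] //= _; case: eqVneq => //= n; rewrite ltnS; [exact: p1|exact: p2].
- case=> [[x|x]|] /=.
  + have [h1 h2] := a1 x; split; last by rewrite addnC (leq_trans (alphaU _ _)) ?leq_add.
    by apply: subset_trans (subsetUl _ Z); exact: setSU.
  + have [h1 h2] := a2 x; split; last by rewrite addnC (leq_trans (alphaU _ _)) ?leq_add.
    by rewrite subUset -setUA setUCA subsetUl andbT -setUCA (subset_trans h1) // setUA subsetUr.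
  + by split; [rewrite -setUA setUCA subsetUl | apply: leq_trans aS (leq_addr _ _)].
- move=> v; rewrite !in_setU -orbA => /or3P[vX|vS|vZ].
  + have [top [vt ht]] := c1 v vX; exists (Some (inl top)); split=> /=.
      by rewrite inE vt.
    case=> [[x|x]|] /=; rewrite ?inE ?(negbTE (SX v vX)) ?orbF //.
      move=> vx n; have [|xr vp] := ht x vx; first by apply: contraNneq n => ->.
      by split=> //=; rewrite (negbTE xr) /= inE vp.
    by move=> vx; have [/subsetP/(_ v vx)/(XZ v vX)] := a2 x.
  + exists None; split=> // -[[x|x]|] //= _ _; split=> //; exact: Schi.
  + have [top [vt ht]] := c2 v vZ; exists (Some (inr top)); split=> /=.
      by rewrite inE vt.
    case=> [[x|x]|] /=; rewrite ?inE ?(negbTE (SZ v vZ)) ?orbF //.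
      by move=> vx; have [/subsetP/(_ v vx) vX] := a1 x; case: (XZ v vX vZ).
    move=> vx n; have [|xr vp] := ht x vx; first by apply: contraNneq n => ->.
    by split=> //=; rewrite (negbTE xr) /= inE vp.
- have cov v : v \in X :|: S :|: Z -> exists x, v \in chi x.
    rewrite !in_setU -orbA => /or3P[vX|vS|vZ].
    + by have [x vx _] := top1 v vX; exists (Some (inl x)); rewrite /= inE vx.
    + by exists None.
    + by have [x vx _] := top2 v vZ; exists (Some (inr x)); rewrite /= inE vx.
  move=> u v uW vW e.
  have [uS|uS] := boolP (u \in S).
    by have [x vx] := cov v vW; exists x; split=> //; exact: Schi.
  have [vS|vS] := boolP (v \in S).
    by have [x ux] := cov u uW; exists x; split=> //; exact: Schi.
  move: uW vW; rewrite !in_setU (negbTE uS) (negbTE vS) !orbF.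
  case/orP => hu /orP[hv|hv].
  + by have [x [ux vx]] := e1 u v hu hv e; exists (Some (inl x)); rewrite /= !inE ux vx.
  + by have /sepP/(_ u v hu hv)[_] := sXZ; rewrite e.
  + by have /sepP/(_ v u hv hu)[_] := sXZ; rewrite edge_sym e.
  + by have [x [ux vx]] := e2 u v hu hv e; exists (Some (inr x)); rewrite /= !inE ux vx.
Qed.

(** Each level multiplies alpha by at most 3/4 and adds at most s to the bags; the recursion ends
    when alpha drops below 1. *)
Lemma rooted_dec_of_separations s : (forall W, exists X S Z,
    [/\ W = X :|: S :|: Z, sep X Z, [disjoint S & X :|: Z],
        4 * alpha X <= 3 * alpha W /\ 4 * alpha Z <= 3 * alpha W & alpha S <= s]) ->
  forall j W, alpha W * 3 ^ j < 4 ^ j -> rooted_dec W (j * s).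
Proof.
move=> hsep; elim=> [|j IH] W.
  rewrite muln1 expn0 ltnS leqn0 => /eqP/alpha_eq0 ->; exact: rooted_dec0.
have [X [S [Z [-> sXZ dS [aX aZ] aS]]]] := hsep W => hj.
have piece Y : 4 * alpha Y <= 3 * alpha (X :|: S :|: Z) -> rooted_dec Y (j * s).
  move=> hY; apply: IH; rewrite -(ltn_pmul2l (_ : 0 < 4)) // -expnS.
  apply: leq_ltn_trans hj; rewrite expnS !mulnA [_ * 3]mulnC.
  by rewrite leq_mul2r hY orbT.
by rewrite mulSn; apply: rooted_dec_join => //; exact: piece.
Qed.

Lemma independence_number_induced S : independence_number (induced S) <= alpha S.
Proof.
apply/bigmax_leqP => I iI; rewrite -(card_imset _ val_inj); apply: alpha_ge.
  by apply/subsetP => _ /imsetP[x _ ->]; exact: valP.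
apply/indepP => _ _ /imsetP[x xI ->] /imsetP[y yI ->].
by have /forall_inP/(_ x xI)/forall_inP/(_ y yI) := iI.
Qed.

(** Climbing to parents from any bag containing v reaches the top node of v through bags containing
    v, so these bags are connected. *)
Lemma tree_independence_leq k : rooted_dec [set: G] k -> tree_independence_number G <= k.
Proof.
move=> [T [r [par [rk [chi [p a c e]]]]]].
rewrite /tree_independence_number; case: ex_minnP => m _ hm.
pose D := par_tree p.
apply: (@leq_trans (@decomposition_alpha G D chi)); last first.
  apply/bigmax_leqP => x _; apply: leq_trans (independence_number_induced _) _.
  by have [] := a x.
apply: hm; apply/asboolP; exists D, chi; split=> //; split.
- exact: par_tree_is_tree.
- by move=> u v; exact: e.
move=> v; have [top [vt ht]] := c v (in_setT v).
have tin : (top : D) \in [set x : D | v \in chi x] by rewrite inE.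
pose top' : induced [set x : D | v \in chi x] := exist _ (top : D) tin.
have up (x : induced [set x : D | v \in chi x]) :
    connect (@edge (induced [set x : D | v \in chi x])) x top'.
  have [n] := ubnP (rk (val x)); elim: n x => // n IH x hn.
  have [E|nt] := eqVneq (val x) (top : D).
    by rewrite (_ : x = top') ?connect0 //; exact: val_inj.
  have vx : v \in chi (val x) by have := valP x; rewrite inE.
  have [xr vp] := ht _ vx nt.
  have pin : (par (val x) : D) \in [set x : D | v \in chi x] by rewrite inE.
  apply: connect_trans (IH (exist _ (par (val x) : D) pin) _); last first.
    by apply: leq_trans (p _ xr) _.
  by apply: connect1; rewrite /= /induced_edge /= /par_edge xr eqxx.
split; first by apply/card_gt0P; exists top'.
move=> x y; apply: connect_trans (up x) _.
by rewrite (sym_connect_sym (@edge_sym _)) up.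
Qed.

End Decomposition.

(** * From biclique models to induced minors *)

Lemma connect_homo (T T' : finType) (e : rel T) (e' : rel T') (g : T -> T') :
  (forall x y, e x y -> connect e' (g x) (g y)) ->
  forall x y, connect e x y -> connect e' (g x) (g y).
Proof.
move=> h x y /connectP[p]; elim: p x => [|z p IH] x /= => [_ ->|/andP[exz pth] E].
  exact: connect0.
exact: connect_trans (h _ _ exz) (IH _ pth E).
Qed.

Section MinorMap.
Variable H : sgraph.

Definition fiber (G : sgraph) (phi : G -> option H) h : rel G :=
  fun x y => [&& phi x == Some h, phi y == Some h & edge x y].

(* [phi] sends each vertex to the vertex of [H] it is merged into, and deleted *)
(* vertices to [None].                                                         *)
Definition minor_map (G : sgraph) (phi : G -> option H) :=
  [/\ forall h, exists x, phi x = Some h,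
      forall h x y, phi x = Some h -> phi y = Some h -> connect (fiber phi h) x y
    & forall h h', h != h' ->
        edge h h' <-> exists x y, [/\ phi x = Some h, phi y = Some h' & edge x y]].

Lemma minor_map_delete (G : sgraph) (phi : G -> option H) v :
  phi v = None -> minor_map phi ->
  minor_map (fun x : delete_vertex v => phi (val x)).
Proof.
move=> pv [sur con adj].
have nv x h : phi x = Some h -> x \in [set~ v].
  by move=> px; rewrite !inE; apply: contra_eq_neq px => ->; rewrite pv.
split.
- by move=> h; have [x px] := sur h; exists (exist _ x (nv x h px)).
- move=> h x y px py; have := con h _ _ px py.
  move=> /(@connect_homo _ _ _ (fiber (fun x : delete_vertex v => phi (val x)) h) (insubd x)).
  rewrite !valKd; apply => a b /and3P[/eqP pa /eqP pb e]; apply: connect1.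
  by rewrite /fiber !insubdK ?(nv _ h) //= /induced_edge pa pb !eqxx !insubdK ?(nv _ h).
- move=> h h' n; split=> [/(adj h h' n)[x [y [px py e]]]|[x [y [px py e]]]].
    by exists (exist _ x (nv x h px)), (exist _ y (nv y h' py)).
  by apply/adj => //; exists (val x), (val y).
Qed.

(** Contracting an edge inside a fibre preserves connectedness of fibres and adjacency between
    distinct ones. *)
Lemma minor_map_contract (G : sgraph) (phi : G -> option H) (u v : G) h0 :
  phi u = Some h0 -> phi v = Some h0 -> edge u v -> minor_map phi ->
  minor_map (fun x : contract u v => phi (val x)).
Proof.
move=> pu pv euv [sur con adj].
have nuv : u != v by apply: contraTneq euv => ->; rewrite edge_irr.
pose u' : contract u v := exist _ u nuv.
pose g : G -> contract u v := insubd u'.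
have gE x : val (g x) = if x == v then u else x by rewrite val_insubd; case: eqP.
have pg x : phi (val (g x)) = phi x.
  by rewrite gE; case: eqP => // ->; rewrite pu pv.
have ge x y : val (g x) != val (g y) -> edge x y -> edge (g x) (g y).
  move=> n e; rewrite /= /contract_edge n /= !gE.
  have [xv|xv] := eqVneq x v; have [yv|yv] := eqVneq y v.
  - by rewrite xv yv edge_irr in e.
  - by rewrite -xv e eqxx !orbT.
  - by rewrite -yv (edge_sym y x) e eqxx !orbT.
  - by rewrite e.
split.
- by move=> h; have [x px] := sur h; exists (g x); rewrite pg.
- move=> h x y px py; have := con h _ _ px py.
  move=> /(@connect_homo _ _ _ (fiber (fun x : contract u v => phi (val x)) h) g).
  rewrite /g !valKd -/g; apply => a b /and3P[pa pb e].
  have [E|n] := eqVneq (val (g a)) (val (g b)); first by rewrite (val_inj E) connect0.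
  by apply: connect1; rewrite /fiber !pg pa pb ge.
- move=> h h' n; split=> [/(adj h h' n)[x [y [px py e]]]|[x [y [px py e]]]].
    exists (g x), (g y); rewrite !pg; split=> //; apply: ge e.
    by apply: contra_neq n => E; apply: Some_inj; rewrite -px -py -(pg x) -(pg y) E.
  apply/adj => //; move: e => /andP[_ /or3P[e|/andP[/eqP E e]|/andP[/eqP E e]]].
  + by exists (val x), (val y).
  + by exists v, (val y); split=> //; rewrite pv -px E.
  + by exists (val x), v; split=> //; [rewrite pv -py E | rewrite edge_sym].
Qed.

Lemma minor_map_iso (G : sgraph) (phi : G -> option H) :
  (forall x, phi x != None) -> injective phi -> minor_map phi -> graph_iso H G.
Proof.
move=> tot inj [sur _ adj].
have /choice[f fP] := sur.
have /choice[g gP] : forall x, exists h, phi x = Some h.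
  by move=> x; case E: (phi x) (tot x) => [h|//] _; exists h.
exists f.
  exists g => [h|x]; first by apply: Some_inj; rewrite -gP fP.
  by apply: inj; rewrite fP -gP.
move=> h h'; have [->|n] := eqVneq h h'; first by rewrite !edge_irr.
apply/idP/idP => [e|/(adj h h' n)[x [y [px py e]]]].
  by apply/adj => //; exists (f h), (f h').
by rewrite -(inj x (f h)) ?px // -(inj y (f h')) ?py.
Qed.

(** Induction on the number of vertices: delete a vertex sent to [None], or contract the first edge
    of a path inside a fibre with two vertices; if neither exists, the map is an isomorphism. *)
Lemma minor_map_induced_minor (G : sgraph) (phi : G -> option H) :
  minor_map phi -> induced_minor H G.
Proof.
have [n] := ubnP #|G|; elim: n G phi => // n IH G phi hn mm.
have [/existsP[v /eqP pv]|/existsPn tot] := boolP [exists v, phi v == None].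
  apply: (@induced_minor_delete H G v); apply: IH (minor_map_delete pv mm).
  rewrite card_sig -ltnS; apply: leq_trans hn; rewrite ltnS.
  by apply: proper_card; apply/properP; split; [exact/subsetP|exists v; rewrite ?inE ?eqxx].
have [inj|] := pselect (injective phi).
  by apply: induced_minor_iso; exact: minor_map_iso tot inj mm.
move=> /existsNP[u] /existsNP[w] /not_implyP[puw /eqP nuw].
case pu: (phi u) (tot u) => [h|//] _.
have [_ con _] := mm.
have /connectP[[|v p] /= pth E] : connect (fiber phi h) u w.
- by apply: con; rewrite -?puw.
- by rewrite E eqxx in nuw.
have /andP[/and3P[_ /eqP pv e] _] := pth.
apply: (@induced_minor_contract H G u v e); apply: IH (minor_map_contract pu pv e mm).
rewrite card_sig -ltnS; apply: leq_trans hn; rewrite ltnS.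
by apply: proper_card; apply/properP; split; [exact/subsetP|exists v; rewrite ?inE ?eqxx].
Qed.

End MinorMap.

Lemma biclique_model_induced_minor (G : sgraph) t :
  biclique_model G t -> induced_minor (complete_bipartite t t) G.
Proof.
move=> [As [Bs [[cA cB pA pB hAB] sA sB]]].
pose F (h : complete_bipartite t t) : {set G} :=
  match h with inl i => nth set0 As i | inr j => nth set0 Bs j end.
have inA (i : 'I_t) : nth set0 As i \in As by rewrite mem_nth ?sA.
have inB (i : 'I_t) : nth set0 Bs i \in Bs by rewrite mem_nth ?sB.
have cF h : conn (F h) by case: h => i; [exact: (allP cA _ (inA i)) | exact: (allP cB _ (inB i))].
have sepF (Xs : seq {set G}) (i j : 'I_t) : size Xs = t -> pairwise (@sep G) Xs ->
    i != j -> sep (nth set0 Xs i) (nth set0 Xs j).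
  move=> sX /(pairwiseP set0) h; rewrite neq_ltn => /orP[] lt.
    by apply: h; rewrite // inE sX.
  by rewrite sepC; apply: h; rewrite // inE sX.
have adjF h h' : h != h' -> edge h h' = ~~ sep (F h) (F h').
  case: h => i; case: h' => j //= n.
  - by rewrite (sepF As i j).
  - by have [_ ->] := hAB _ _ (inA i) (inB j).
  - by have [_] := hAB _ _ (inA j) (inB i); rewrite sepC => ->.
  - by rewrite (sepF Bs i j).
have disjF h h' x : x \in F h -> x \in F h' -> h = h'.
  move=> xh xh'; apply/eqP; apply: contraT => n.
  case: h h' xh xh' n => i [] j /= xi xj n.
  - by case: (sep_disj (sepF As i j sA pA n) xi xj).
  - by have [/pred0P/(_ x)] := hAB _ _ (inA i) (inB j); rewrite /= xi xj.
  - by have [/pred0P/(_ x)] := hAB _ _ (inA j) (inB i); rewrite /= xi xj.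
  - by case: (sep_disj (sepF Bs i j sB pB n) xi xj).
pose phi (x : G) := [pick h | x \in F h].
have phiP x h : (phi x == Some h) = (x \in F h).
  rewrite /phi; case: pickP => [h' xh'|no]; last by rewrite no.
  apply/eqP/idP => [[<-]//|xh]; congr Some; exact: disjF xh' xh.
apply: (@minor_map_induced_minor _ _ phi); split.
- move=> h; have /connP[/set0Pn[x xh] _] := cF h.
  by exists x; apply/eqP; rewrite phiP.
- move=> h x y /eqP; rewrite phiP => xh /eqP; rewrite phiP => yh.
  have /connP[_ /(_ x y xh yh)] := cF h.
  by rewrite (@eq_connect _ _ (inside (F h))) // => a b; rewrite /fiber !phiP.
- move=> h h' n; rewrite adjF //; split.
    case/nsepP => x [y [xh yh' /orP[/eqP E|e]]].
      by move: n; rewrite E in xh; rewrite (disjF _ _ _ xh yh') eqxx.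
    by exists x, y; split=> //; apply/eqP; rewrite phiP.
  case=> x [y [/eqP]]; rewrite phiP => xh /eqP; rewrite phiP => yh e.
  by apply/nsepP; exists x, y; rewrite e orbT.
Qed.
(** * The bound *)

Section FinalBound.
Variables (G : sgraph) (t : nat).
Hypothesis nomodel : ~ biclique_model G t.
Hypothesis t0 : 0 < t.

(** T stands for sqrt n: since alpha(W) <= T^2, [density] makes both terms of [separation] multiples
    of T^2. Depth 3l suffices because 2 (3/4)^3 < 1. *)
Lemma tree_independence_nat l T : 0 < l -> #|G| <= 2 ^ l -> 0 < T -> T <= 2 ^ l ->
  #|G| <= T ^ 2 ->
  tree_independence_number G
    <= 3 * l * ((18 * dens_const t l + 32 * t ^ 2) * l * T).
Proof.
move=> l0 cG T0 Tl GT; apply: tree_independence_leq.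
set s := (_ + _) * l * T.
apply: (@rooted_dec_of_separations G s).
  move=> W; have [X [S [Z [WE sXZ dS hXZ hS]]]] := separation nomodel t0 l0 cG W T0 Tl.
  exists X, S, Z; split=> //; rewrite -(leq_pmul2l T0); apply: leq_trans hS _.
  have aT : alpha W <= T ^ 2 by apply: leq_trans (alpha_card W) (leq_trans (max_card _) GT).
  have hd : walpha (deg W) W <= 2 * dens_const t l * T ^ 2.
    apply: leq_trans (density nomodel t0 l0 cG W) _.
    by rewrite leq_mul2l aT orbT.
  apply: (@leq_trans (9 * l * (2 * dens_const t l * T ^ 2) + 32 * t ^ 2 * l * T ^ 2)).
    by rewrite leq_add2r leq_mul2l hd orbT.
  by rewrite /s; apply: eq_leq; move: (dens_const t l); clear; lia.
rewrite expnM [4 ^ _]expnM.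
apply: (@leq_ltn_trans (2 ^ l * (3 ^ 3) ^ l)).
  by rewrite leq_mul2r (alpha_leq_pow cG) orbT.
by rewrite -expnMn ltn_exp2r.
Qed.

End FinalBound.

(** [gap_const] is a constant times l^4, whence the exponent 8(2t + 2). *)
Lemma dens_const_poly t : exists c e, forall l, 0 < l -> dens_const t l <= c * l ^ e.
Proof.
pose A := 2000 * t ^ 4 * (864 * (1536 * t ^ 2)) ^ 2.
exists (A ^ (2 * t).+2).+1, (8 * (2 * t).+2) => l l0.
have -> : dens_const t l = (A ^ (2 * t).+2 * l ^ (8 * (2 * t).+2)).+1.
  rewrite /dens_const expnM -expnMn; congr (_ ^ _).+1.
  rewrite /gap_const /step_const /A.
  have E k : 2000 * t ^ 4 * k ^ 2 * l ^ 8 = 2000 * t ^ 4 * (k * l ^ 4) ^ 2.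
    by rewrite expnMn -expnM mulnA.
  by rewrite E; congr (_ * _ ^ _); clear; lia.
by rewrite [X in _ <= X]mulSnr -addn1 leq_add2l expn_gt0 l0.
Qed.

Local Open Scope ring_scope.

Lemma le_sqrt_nat (R : realType) (m n : nat) : (m ^ 2 <= n)%N -> m%:R <= Num.sqrt n%:R :> R.
Proof.
move=> h; rewrite -[m%:R]ger0_norm ?ler0n // -sqrtr_sqr ler_sqrt ?ler0n //.
by rewrite -natrX ler_nat.
Qed.

Lemma le_log2_nat (R : realType) (m n : nat) : (2 ^ m <= n)%N -> m%:R <= log2 (n%:R : R).
Proof.
move=> h; have ln2 : 0 < ln (2 : R) by rewrite ln_gt0 // ltr1n.
rewrite /log2 ler_pdivlMr // mulr_natl -lnXn ?ltr0n // -natrX.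
by rewrite ler_ln ?posrE ?ltr0n ?ler_nat ?expn_gt0 // (leq_trans _ h) ?expn_gt0.
Qed.

Unset Implicit Arguments.

Theorem theorem1p3 (R : realType) (t : nat) (t_gt0 : (0 < t)%N) :
  exists d : nat, (0 < d)%N /\
  exists (C : R) (n0 : nat), 0 < C /\
  forall G : sgraph,
    ~ induced_minor (complete_bipartite t t) G ->
    (n0 <= #|G|)%N ->
    (tree_independence_number G)%:R
      <= C * (Num.sqrt (#|G|%:R) * log2 (#|G|%:R) ^+ d).
Proof.
have [c [e hce]] := dens_const_poly t.
have [K KE] : exists K, K = (3 * (18 * c + 32 * t ^ 2))%N by eexists.
(* Two factors l besides l^e come from the depth of the tree and from [separation]. The powers of 2
   come from l <= 2 log n and T <= 2 sqrt n, the former using n >= 2. *)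
exists e.+2; split=> //; exists (K.+1%:R * 2 ^+ e.+3), 2%N; split.
  by rewrite mulr_gt0 ?ltr0n ?exprn_gt0.
move=> G nmin n2; set n := #|G| in n2 *.
have nomodel : ~ biclique_model G t by move=> /biclique_model_induced_minor.
have exT : exists T, (n <= T ^ 2)%N.
  by exists n; rewrite -mulnn leq_pmulr // (leq_trans _ n2).
have [T nT minT] := ex_minnP exT.
have T0 : (0 < T)%N.
  by rewrite lt0n; apply/negP => /eqP E; move: nT; rewrite E leqNgt (leq_trans _ n2).
have [l [l0 nl ln]] : exists l, [/\ (0 < l)%N, (n <= 2 ^ l)%N & (2 ^ l.-1 <= n)%N].
  exists (up_log 2 n); have /andP[h1 h2] := up_log_bounds (isT : (1 < 2)%N) n2.
  split=> //; last exact: ltnW.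
  by rewrite up_log_gt0 /= n2.
have Tl : (T <= 2 ^ l)%N.
  by apply: leq_trans nl; apply: minT; rewrite -mulnn leq_pmulr // (leq_trans _ n2).
(* By minimality of T, T - 1 is at most sqrt n, and so is 1. *)
have hT : T%:R <= 2 * Num.sqrt n%:R :> R.
  have h1 : T.-1%:R <= Num.sqrt n%:R :> R.
    apply: le_sqrt_nat; rewrite leqNgt; apply/negP => /ltnW/minT.
    by rewrite leqNgt ltn_predL T0.
  have h2 : 1%:R <= Num.sqrt n%:R :> R by apply: le_sqrt_nat; exact: ltnW.
  by rewrite -(prednK T0) -addn1 natrD mulr_natl mulr2n lerD.
have hl : l%:R <= 2 * log2 (n%:R : R).
  have h1 := @le_log2_nat R l.-1 n ln; have h2 := @le_log2_nat R 1 n n2.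
  by rewrite -(prednK l0) -addn1 natrD mulr_natl mulr2n lerD.
have h0 : 0 <= log2 (n%:R : R) by have := @le_log2_nat R 1 n n2; apply: le_trans; rewrite ler0n.
have hN := tree_independence_nat nomodel t_gt0 l0 nl T0 Tl nT.
have hK : (tree_independence_number G <= K * l ^ e.+2 * T)%N.
  apply: leq_trans hN _.
  apply: (@leq_trans (3 * l * ((18 * (c * l ^ e) + 32 * t ^ 2 * l ^ e) * l * T))%N).
    have hPQ : (18 * dens_const t l + 32 * t ^ 2 <= 18 * (c * l ^ e) + 32 * t ^ 2 * l ^ e)%N.
      by apply: leq_add; [rewrite leq_mul2l hce | rewrite leq_pmulr // expn_gt0 l0].
    exact: leq_mul (leqnn _) (leq_mul (leq_mul hPQ (leqnn _)) (leqnn _)).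
  by rewrite KE !expnS; apply: eq_leq; move: (l ^ e)%N => x; clear; lia.
apply: (@le_trans _ _ (K * l ^ e.+2 * T)%:R); first by rewrite ler_nat.
rewrite natrM (natrM _ K) natrX.
apply: (@le_trans _ _ (K.+1%:R * (2 * log2 n%:R) ^+ e.+2 * (2 * Num.sqrt n%:R))).
  have hle : l%:R ^+ e.+2 <= (2 * log2 n%:R) ^+ e.+2 :> R.
    by apply: lerXn2r; rewrite // nnegrE ?ler0n // mulr_ge0.
  have hKl : K%:R * l%:R ^+ e.+2 <= K.+1%:R * (2 * log2 n%:R) ^+ e.+2 :> R.
    by apply: ler_pM => //; rewrite ?exprn_ge0 ?ler0n ?ler_nat.
  by apply: ler_pM => //; rewrite ?ler0n // mulr_ge0 ?exprn_ge0 ?ler0n.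
rewrite le_eqVlt; apply/orP; left; apply/eqP.
rewrite exprMn (exprS 2 e.+2); move: (2 ^+ e.+2) (log2 _ ^+ _) (Num.sqrt _) => x y z.
rewrite -!mulrA; congr (_ * _); rewrite [RHS]mulrCA; congr (_ * _).
by rewrite mulrCA; congr (_ * _); exact: mulrC.
Qed.
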